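(* Let $T>0$, $\rho\in\mathbb R$ with $|\rho|<1$, and $0<\lambda<\infty$. Let $X(t)=Z(t)+J(t)$, $t\in[0,T]$, where $Z$ and $J$ are independent processes, $Z$ is a centered stationary Gaussian process with $C^1$ paths and covariance function $\Gamma(\tau)=\mathbb E Z(0)Z(\tau)$ satisfying $\Gamma(0)=1/2$, and $J$ is a PAR($\rho,\lambda$) process. Then, as $u\to\infty$, $\mathbb E U^d_u=o\left(\mathbb E U^c_u\right)$.
   Context: Poisson-auto-regressive process PAR($\rho,\lambda$): let $(\epsilon_n)_{n\ge0}$ be i.i.d. centered Gaussian random variables with variance $1/2$, and set $A_0=\epsilon_0$ and $A_n=\rho A_{n-1}+\sqrt{1-\rho^2}\,\epsilon_n$ for $n\ge1$. Let $\nu=(\nu_t)_{t\ge0}$ be a simple Poisson process with intensity $\lambda$ (jump epochs separated by independent exponential times of intensity $\lambda$), independent of $(\epsilon_n)$. Then $J(t)=A_{\nu_t}$. $U^c_u$ is the number of continuous up-crossings of the level $u$ by $X$ on $[0,T]$, i.e. of points $s\in(0,T)$ at which $X$ is continuous with $X(s)=u$ and $\dot X(s)>0$. $U^d_u$ is the number of discontinuous up-crossings of the level $u$ by $X$ on $[0,T]$, i.e. of points $s$ with $X(s^-)<u<X(s)$. The notation $f(u)=o(g(u))$ means that $\lim_{u\to\infty}f(u)/g(u)=0$.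
   Formalization: The formal statement adds that Γ is not constant on [0,T]: if Γ ≡ 1/2 there, Z is a.s. constant in time, so E U^c_u = 0 while E U^d_u > 0, and the claimed o(·) fails. *)

(* Defs.v *)
From HB Require Import structures.
From mathcomp Require Import all_boot all_order all_algebra.
From mathcomp Require Import all_classical all_reals all_analysis.

Set Implicit Arguments.
Unset Strict Implicit.
Unset Printing Implicit Defensive.

Import Order.TTheory GRing.Theory Num.Theory.
Import numFieldNormedType.Exports.

Local Open Scope classical_set_scope.
Local Open Scope ring_scope.

(* Laws are compared on measurable sets only: a probability is a function on
   all subsets, but its values elsewhere carry no meaning. *)
Definition has_law d (Omega : measurableType d) (R : realType)
    (P : probability Omega R) (Y : Omega -> R) (mu : set R -> \bar R) : Prop :=
  forall B : set R, measurable B -> P (Y @^-1` B) = mu B.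

Definition mutually_independent d (Omega : measurableType d) (R : realType)
    (P : probability Omega R) (Y : nat -> Omega -> R) : Prop :=
  forall (s : seq nat) (B : nat -> set R), uniq s ->
    (forall i, measurable (B i)) ->
    P (\bigcap_(i in [set` s]) Y i @^-1` B i) =
    (\prod_(i <- s) P (Y i @^-1` B i))%E.

Definition iid_with_law d (Omega : measurableType d) (R : realType)
    (P : probability Omega R) (Y : nat -> Omega -> R)
    (mu : set R -> \bar R) : Prop :=
  mutually_independent P Y /\ forall n, has_law P (Y n) mu.

Definition sigma_process d d' (Omega : measurableType d)
    (S : measurableType d') (I : Type) (D : set I) (Y : I -> Omega -> S) :
    set (set Omega) :=
  <<s \bigcup_(i in D) preimage_set_system setT (Y i) measurable >>.

Definition independent_systems d (Omega : measurableType d) (R : realType)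
    (P : probability Omega R) (F G : set (set Omega)) : Prop :=
  forall A B : set Omega, F A -> G B -> P (A `&` B) = (P A * P B)%E.

(* [normal_prob m 0] is not the Dirac mass at [m] in the library, hence the
   case distinction for degenerate Gaussian variables. *)
Definition gaussian_variable d (Omega : measurableType d) (R : realType)
    (P : probability Omega R) (Y : Omega -> R) : Prop :=
  exists m s : R,
    has_law P Y (if s == 0 then dirac m : set R -> \bar R
                 else normal_prob m s).

Definition gaussian_process d (Omega : measurableType d) (R : realType)
    (P : probability Omega R) (D : set R) (Z : R -> Omega -> R) : Prop :=
  forall (n : nat) (t c : 'I_n -> R), (forall i, D (t i)) ->
    gaussian_variable P (fun w => \sum_(i < n) c i * Z (t i) w).

Definition centered_process d (Omega : measurableType d) (R : realType)
    (P : probability Omega R) (D : set R) (Z : R -> Omega -> R) : Prop :=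
  forall t, D t -> ('E_P[Z t] = 0)%E.

Definition stationary_process d (Omega : measurableType d) (R : realType)
    (P : probability Omega R) (D : set R) (Z : R -> Omega -> R) : Prop :=
  forall (n : nat) (t : 'I_n -> R) (h : R),
    (forall i, D (t i)) -> (forall i, D (t i + h)) ->
    forall B : set (n.-tuple R), measurable B ->
      P [set w | B [tuple Z (t i + h) w | i < n]] =
      P [set w | B [tuple Z (t i) w | i < n]].

(* C^1 on the closed interval [a, b]: the derivative on the open interval
   extends continuously to the endpoints. *)
Definition C1_on (R : realType) (a b : R) (f : R -> R) : Prop :=
  derivable_oo_LRcontinuous f a b /\
  exists2 g : R -> R, {within `[a, b], continuous g} &
    {in `]a, b[, forall t, f^`()%classic t = g t}.

(* The [n.+1]-st jump epoch is the sum of the [n.+1] first waiting times, and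
   [nu t] counts the jump epochs in [0, t]. *)
Definition poisson_process d (Omega : measurableType d) (R : realType)
    (P : probability Omega R) (lambda : R) (nu : R -> Omega -> nat) : Prop :=
  exists W : nat -> {RV P >-> R},
    iid_with_law P W (exponential_prob lambda) /\
    forall (t : R) (w : Omega), 0 <= t ->
      ([set n | (\sum_(i < n.+1) W i w <= t)%R] #= `I_(nu t w))%card.

Fixpoint ar_chain (Omega : Type) (R : realType) (rho : R)
    (eps : nat -> Omega -> R) (n : nat) (w : Omega) : R :=
  match n with
  | 0 => eps 0 w
  | m.+1 => rho * ar_chain rho eps m w + Num.sqrt (1 - rho ^+ 2) * eps m.+1 w
  end.

(* The second parameter of [normal_prob] is the standard deviation. *)
Definition PAR_process d (Omega : measurableType d) (R : realType)
    (P : probability Omega R) (rho lambda : R) (J : R -> Omega -> R) : Prop :=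
  exists (eps : nat -> {RV P >-> R}) (nu : R -> Omega -> nat),
    [/\ iid_with_law P eps (normal_prob 0 (Num.sqrt (1 / 2))),
        poisson_process P lambda nu,
        independent_systems P (sigma_process `[0, +oo[ nu)
                              (sigma_process setT eps) &
        forall (t : R) (w : Omega), 0 <= t ->
          J t w = ar_chain rho eps (nu t w) w].

Definition continuous_upcrossings (R : realType) (T u : R) (x : R -> R) :
    set R :=
  [set s | [/\ s \in `]0, T[, {for s, continuous x}, x s = u,
               derivable x s 1 & 0 < x^`()%classic s]].

(* The time 0 is excluded, as it has no left limit within [0, T]. *)
Definition discontinuous_upcrossings (R : realType) (T u : R) (x : R -> R) :
    set R :=
  [set s | s \in `]0, T] /\
    exists l : R, x t @[t --> s^'-] --> l /\ l < u < x s].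

Definition expected_Uc d (Omega : measurableType d) (R : realType)
    (P : probability Omega R) (T : R) (X : R -> Omega -> R) (u : R) : \bar R :=
  (\int[P]_w counting (continuous_upcrossings T u (fun t => X t w)))%E.

Definition expected_Ud d (Omega : measurableType d) (R : realType)
    (P : probability Omega R) (T : R) (X : R -> Omega -> R) (u : R) : \bar R :=
  (\int[P]_w counting (discontinuous_upcrossings T u (fun t => X t w)))%E.

(* The quotient is taken in [\bar R], where [0^-1 = +oo]: a vanishing [g]
   is not silently accepted. *)
Definition little_o_pinfty (R : realType) (f g : R -> \bar R) : Prop :=
  (f u / g u)%E @[u --> +oo%R] --> 0%E.

(* Main.v *)
(* Write tail u for the tail above u of the common law, centered Gaussian, of the
   variables Z t + J 0.

   A discontinuous up-crossing needs a Poisson jump followed by a value of X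
   above u.  Given the jumps, J t is still N(0, 1/2), so each grid step
   contributes at most P(jump in the step) * tail u, and Fatou's lemma along
   finer grids yields E Ud <= E nu_T * tail u.

   For the continuous up-crossings, split [0, tau] into N steps of length h and
   work on the event that J does not jump, of probability at least
   p0 = P(nu_T = nu_0) > 0, where X t = Z t + J 0 is C^1.  By the intermediate
   value theorem each step with X t < u < X (t + h) contains a crossing, which
   has positive derivative up to an event of arbitrarily small probability.  If
   X (t + h) > u but X t >= u, then X t + X (t + h) > 2 u; since Gamma is not
   constant, the half-sum has a strictly smaller variance than X t, so this has
   probability o(tail u).  Hence E Uc >= N p0 tail u - o(tail u) for every N. *)

Require Import Defs.
From HB Require Import structures.
From mathcomp Require Import all_boot all_order all_algebra finmap.
From mathcomp Require Import all_classical all_reals all_analysis.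
From mathcomp Require Import measurable_realfun ring lra.

Set Implicit Arguments.
Unset Strict Implicit.
Unset Printing Implicit Defensive.

Import Order.TTheory GRing.Theory Num.Theory.
Import numFieldNormedType.Exports.

Local Open Scope classical_set_scope.
Local Open Scope ring_scope.

Import HBNNSimple.

(** * Gaussian laws and sums of independent variables *)

(** Z is independent of J, and the law of J given its jumps is known through the counter [nu], but
    nothing relates Z to [nu] directly. Jump events are therefore stated through values of J, and
    compared with events of [nu] only after the independence of Z has been used: a change of J
    forces a change of [nu], and a constant [nu] forces a constant J. These are inclusions, not
    equalities, so the law of a sum of independent variables is needed in the form of one-sided
    bounds. The numbers of crossings are not shown to be measurable. They are only compared with
    measurable functions, a lower limit of sums of indicators above and a finite sum of indicators
    below, by monotonicity of the integral. A constant [Gamma] would freeze Z: almost surely Z t = Z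
    0 for all t, and X would have no continuous up-crossing at all. Non-constancy enters only
    through the strict loss of variance of a half-sum. *)

(** By monotone convergence both sides are limits along the same simple functions, and for a simple
    function the identity reduces to the hypothesis on its level sets. *)
Lemma ge0_integral_density d (S : measurableType d) (R : realType)
    (mu nu : {measure set S -> \bar R}) (g : S -> R) (f : S -> \bar R) :
  measurable_fun setT g -> (forall x, 0 <= g x) ->
  (forall A, measurable A -> nu A = (\int[mu]_(x in A) (g x)%:E)%E) ->
  measurable_fun setT f -> (forall x, 0 <= f x)%E ->
  (\int[nu]_x f x = \int[mu]_x (f x * (g x)%:E))%E.
Proof.
move=> mg g0 nuE mf f0.
pose h := nnsfun_approx measurableT mf.
have hf x : (EFin \o h n) x @[n --> \oo] --> f x by exact: cvg_nnsfun_approx.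
have ndh x : {homo (fun n => (h n x)%:E) : a b / (a <= b)%N >-> (a <= b)%E}.
  by move=> a b ab; rewrite lee_fin; exact/lefP/nd_nnsfun_approx.
have -> : (\int[nu]_x f x =
    lim (\int[nu]_x (EFin \o h n) x @[n --> \oo]))%E.
  rewrite -monotone_convergence//.
  - by apply: eq_integral => x _; apply/esym/cvg_lim.
  - by move=> n; apply/measurable_EFinP.
  - by move=> n x _; rewrite /= lee_fin.
  - by move=> x _ a b ab; exact: ndh.
have -> : (\int[mu]_x (f x * (g x)%:E) =
    lim (\int[mu]_x ((h n x)%:E * (g x)%:E) @[n --> \oo]))%E.
  rewrite -monotone_convergence//.
  - apply: eq_integral => x _; apply/esym/cvg_lim => //.
    by apply: cvgeZr => //; exact: hf.
  - by move=> n; apply/measurable_EFinP/measurable_funM.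
  - by move=> n x _; rewrite -EFinM lee_fin mulr_ge0.
  - by move=> x _ a b ab; rewrite lee_wpmul2r ?lee_fin//; exact: ndh.
congr (limn _); apply/funext => n.
have indic0 r x : (0 <= (r * \1_(h n @^-1` [set r]) x)%:E)%E.
  by rewrite EFinM nnfun_muleindic_ge0.
have mindic r : measurable_fun setT (fun x => (r * \1_(h n @^-1` [set r]) x)%:E).
  by apply/measurable_EFinP; exact: measurable_funM.
under eq_integral do rewrite /= fimfunE -fsumEFin//.
rewrite ge0_integral_fsum//.
under [RHS]eq_integral do rewrite fimfunE -fsumEFin// ge0_mule_fsuml//.
rewrite ge0_integral_fsum//; last 2 first.
- move=> r; apply: emeasurable_funM => //; exact/measurable_EFinP.
- by move=> r x _; rewrite mule_ge0// lee_fin.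
apply: eq_fsbigr => r; rewrite inE => -[z _ rE].
have r0 : 0 <= r by rewrite -rE.
under eq_integral do rewrite EFinM.
rewrite ge0_integralZl//; last exact/measurable_EFinP.
under [RHS]eq_integral do rewrite EFinM -muleA.
rewrite ge0_integralZl//; last 2 first.
- apply: emeasurable_funM; exact/measurable_EFinP.
- by move=> x _; rewrite mule_ge0 ?lee_fin.
congr (_ * _)%E.
rewrite integral_indic// setIT nuE// integral_mkcond.
apply: eq_integral => x _; rewrite patchE indicE.
by case: ifPn => _; rewrite ?mul1e ?mul0e.
Qed.

(** The existential hides the measure structure of [pushforward], which depends on the proof that
    [f] is measurable; only the two identities remain visible. *)
Lemma pushforward_measureP d d' (S : measurableType d) (U : measurableType d')
    (R : realType) (m : {measure set S -> \bar R}) (f : S -> U) :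
  measurable_fun setT f ->
  exists nu : {measure set U -> \bar R}, (forall A, nu A = m (f @^-1` A)) /\
    forall h : U -> \bar R, measurable_fun setT h -> (forall x, 0 <= h x)%E ->
    (\int[nu]_x h x = \int[m]_x h (f x))%E.
Proof.
move=> mf.
unshelve eexists (pushforward m f : {measure set U -> \bar R}) => //; split=> //.
by move=> h mh h0; rewrite ge0_integral_pushforward//; rewrite preimage_setT.
Qed.

(** The left-hand side is a measure in [A], and it gives intervals []a, b]] their length; uniqueness
    of Lebesgue measure does the rest. A negative [c] only exchanges the open and the closed end. *)
Lemma lebesgue_measure_affine (R : realType) (c y : R) (A : set R) :
  c != 0 -> measurable A ->
  (`|c|%:E * lebesgue_measure [set x | A (c * x + y)%R] = lebesgue_measure A)%E.
Proof.
move=> c0 mA.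
have mphi : measurable_fun [set: measurableTypeR R]
    ((fun x => c * x + y) : measurableTypeR R -> measurableTypeR R).
  by apply: measurable_funD => //; exact: measurable_funM.
have [m [mE _]] := pushforward_measureP lebesgue_measure mphi.
pose nu : {measure set (measurableTypeR R) -> \bar R} :=
  mscale (NngNum (normr_ge0 c)) m.
have nuE B : nu B = (`|c|%:E * lebesgue_measure [set x | B (c * x + y)%R])%E.
  by transitivity (`|c|%:E * m B)%E => //; rewrite mE.
rewrite -nuE; apply/esym.
apply: lebesgue_measure_unique => //.
move=> _ [[a b] _ <-].
rewrite nuE lebesgue_measure_itv/=.
have [c_gt0|c_lt0|c_eq0] := ltgtP 0 c; last by rewrite c_eq0 eqxx in c0.
- have -> : [set x | c * x + y \in `]a, b]] = `](a - y) / c, (b - y) / c]%classic.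
    apply/seteqP; split => x /=; rewrite !in_itv/=.
      by rewrite ltr_pdivrMr// ler_pdivlMr// ltrBlDr lerBrDr mulrC.
    by rewrite ltr_pdivrMr// ler_pdivlMr// ltrBlDr lerBrDr mulrC.
  rewrite lebesgue_measure_itv/= !lte_fin ltr_pM2r ?invr_gt0// ltrD2r.
  case: ifPn => _; last by rewrite mule0.
  rewrite -!EFinD -EFinM gtr0_norm//; congr EFin; field.
  exact: c0.
- have -> : [set x | c * x + y \in `]a, b]] = `[(b - y) / c, (a - y) / c[%classic.
    apply/seteqP; split => x /=; rewrite !in_itv/=.
      by rewrite ltr_ndivlMr// ler_ndivrMr// ltrBlDr lerBrDr mulrC andbC.
    by rewrite ltr_ndivlMr// ler_ndivrMr// ltrBlDr lerBrDr mulrC andbC.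
  rewrite lebesgue_measure_itv/= !lte_fin ltr_nM2r ?invr_lt0// ltrD2r.
  case: ifPn => _; last by rewrite mule0.
  rewrite -!EFinD -EFinM ltr0_norm//; congr EFin; field.
  exact: c0.
Qed.

Lemma ge0_integral_affine (R : realType) (c y : R) (f : R -> \bar R) :
  c != 0 -> measurable_fun setT f -> (forall x, 0 <= f x)%E ->
  (\int[lebesgue_measure]_x f x =
   `|c|%:E * \int[lebesgue_measure]_x f (c * x + y)%R)%E.
Proof.
move=> c0 mf f0.
have mphi : measurable_fun [set: measurableTypeR R]
    ((fun x => c * x + y) : measurableTypeR R -> measurableTypeR R).
  by apply: measurable_funD => //; exact: measurable_funM.
have [m [mE mI]] := pushforward_measureP lebesgue_measure mphi.
rewrite (@eq_measure_integral _ _ _ setT (mscale (NngNum (normr_ge0 c)) m)) //=.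
  rewrite ge0_integral_mscale//=; congr (_ * _)%E.
  by rewrite mI.
move=> A mA _; rewrite -(@lebesgue_measure_affine _ c y A)//.
by rewrite /mscale /= mE.
Qed.

Definition gauss (R : realType) (m s : R) : set R -> \bar R :=
  if s == 0 then dirac m else normal_prob m s.

Lemma normal_pdf_affine (R : realType) (m s c y x : R) : c != 0 -> s != 0 ->
  normal_pdf m s x = `|c| * normal_pdf (c * m + y) (c * s) (c * x + y).
Proof.
move=> c0 s0; have cs0 : c * s != 0 by rewrite mulf_neq0.
rewrite !normal_pdfE// mulrA; congr (_ * _).
  rewrite /normal_peak -!mulrnAr exprMn -(mulrA (c ^+ 2)) [in RHS]sqrtrM ?sqr_ge0// sqrtr_sqr.
  by rewrite invfM mulrA divff ?mul1r// normr_eq0.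
rewrite /normal_fun; congr expR.
have -> : c * x + y - (c * m + y) = c * (x - m) by ring.
rewrite !exprMn.
have -> : c ^+ 2 * s ^+ 2 *+ 2 = c ^+ 2 * (s ^+ 2 *+ 2) by rewrite mulrnAr.
have -> : - (c ^+ 2 * (x - m) ^+ 2) = c ^+ 2 * (- (x - m) ^+ 2) by rewrite mulrN.
by rewrite -mulf_div divff ?mul1r ?sqrf_eq0.
Qed.

(** Apart from the degenerate cases [s = 0] and [c = 0], where both sides are a Dirac mass, this is
    the affine change of variables in the density. *)
Lemma gauss_affine (R : realType) (m s c y : R) (B : set R) : measurable B ->
  gauss m s [set x | B (c * x + y)] = gauss (c * m + y) (c * s) B.
Proof.
move=> mB; rewrite /gauss mulf_eq0.
have [->/=|s0] := eqVneq s 0.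
  by rewrite orbT !diracE; congr (_%:R%:E); apply/idP/idP; rewrite !inE.
have [->/=|c0/=] := eqVneq c 0.
  rewrite mul0r add0r diracE /normal_prob.
  have [yB|yB] := boolP (y \in B).
    rewrite (_ : [set x | _] = setT) ?integral_normal_pdf//.
    by apply/seteqP; split => // x _ /=; rewrite mul0r add0r; rewrite inE in yB.
  rewrite (_ : [set x | _] = set0) ?integral_set0//.
  apply/seteqP; split => // x /=; rewrite mul0r add0r.
  by move/mem_set; rewrite (negbTE yB).
rewrite /normal_prob.
have mpdf : measurable_fun setT
    ((fun z => (normal_pdf (c * m + y) (c * s) z)%:E) \_ B).
  apply/(measurable_restrictT _ _).1 => //; apply: measurable_funTS.
  by apply/measurable_EFinP; exact: measurable_normal_pdf.
have pdf0 z : (0 <= ((fun z => (normal_pdf (c * m + y) (c * s) z)%:E) \_ B) z)%E.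
  by apply: erestrict_ge0 => t _; rewrite lee_fin normal_pdf_ge0.
rewrite [RHS]integral_mkcond [LHS]integral_mkcond [RHS](ge0_integral_affine y c0)//.
rewrite -ge0_integralZl//; last first.
  apply: (measurableT_comp mpdf).
  by apply: measurable_funD => //; exact: measurable_funM.
apply: eq_integral => x _; rewrite !patchE.
have -> : (x \in [set x0 | B (c * x0 + y)]) = (c * x + y \in B).
  by apply/idP/idP; rewrite !inE.
by case: ifPn => _; rewrite ?mule0// -EFinM -normal_pdf_affine.
Qed.

(** Completing the square in [y], that is, Bayes' formula: prior times likelihood equals the
    marginal density of [z] times the posterior density of [y]. The last factor integrates to 1 in
    [y]. *)
Lemma normal_pdf_mul (R : realType) (m s b y z : R) : s != 0 -> b != 0 ->
  normal_pdf m s y * normal_pdf y b z =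
  normal_pdf m (Num.sqrt (s ^+ 2 + b ^+ 2)) z *
  normal_pdf ((b ^+ 2 * m + s ^+ 2 * z) / (s ^+ 2 + b ^+ 2))
    (s * b / Num.sqrt (s ^+ 2 + b ^+ 2)) y.
Proof.
move=> s0 b0; set v := s ^+ 2 + b ^+ 2.
have v_gt0 : 0 < v by rewrite ltr_pwDl ?sqr_ge0// exprn_even_gt0.
have sv0 : Num.sqrt v != 0 by rewrite gt_eqF ?sqrtr_gt0.
have svK : Num.sqrt v ^+ 2 = v by rewrite sqr_sqrtr// ltW.
have sbv0 : s * b / Num.sqrt v != 0 by rewrite !mulf_neq0 ?invr_eq0.
have sbvE : (s * b / Num.sqrt v) ^+ 2 = s ^+ 2 * b ^+ 2 / v.
  by rewrite expr_div_n exprMn svK.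
rewrite !normal_pdfE// [LHS]mulrACA [RHS]mulrACA; congr (_ * _).
  rewrite /normal_peak -!invfM -!sqrtrM; last 2 first.
  - by rewrite mulrn_wge0// mulr_ge0 ?sqr_ge0// pi_ge0.
  - by rewrite mulrn_wge0// mulr_ge0 ?sqr_ge0// pi_ge0.
  congr (Num.sqrt _)^-1; rewrite sbvE svK.
  have := gt_eqF v_gt0; move: v {v_gt0 sv0 svK sbv0 sbvE} => v v0.
  by field; rewrite v0.
rewrite /normal_fun -!expRD; congr expR; rewrite sbvE svK /v.
by field; rewrite s0 b0 /= (gt_eqF v_gt0).
Qed.

Lemma normal_prob_abs (R : realType) (m s : R) :
  normal_prob m `|s| = normal_prob m s.
Proof.
apply/funext => A; apply: eq_integral => x _; congr EFin.
rewrite /normal_pdf normr_eq0; case: ifPn => // _.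
by rewrite /normal_peak /normal_fun real_normK ?num_real.
Qed.

Lemma measurable_normal_pdf2 (R : realType) (b : R) : b != 0 ->
  measurable_fun setT (fun p : R * R => normal_pdf p.1 b p.2).
Proof.
move=> b0; under eq_fun do rewrite normal_pdfE//.
apply: measurable_funM => //; apply: measurableT_comp => //.
apply: measurable_funM => //; apply: measurableT_comp => //.
apply: measurable_funX; exact: measurable_funB.
Qed.

Lemma measurable_normal_prob (R : realType) (b : R) (B : set R) :
  b != 0 -> measurable B -> measurable_fun setT (fun y => normal_prob y b B).
Proof.
move=> b0 mB; pose f (p : R * R) := (normal_pdf p.1 b p.2 * \1_B p.2)%:E.
have -> : (fun y => normal_prob y b B) = fubini_F lebesgue_measure f.
  apply/funext => y; rewrite /normal_prob integral_mkcond.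
  apply: eq_integral => z _; rewrite patchE /f /= indicE.
  by case: ifPn; rewrite ?mulr1 ?mulr0.
apply: measurable_fun_fubini_tonelli_F.
  apply/measurable_EFinP; apply: measurable_funM.
    exact: measurable_normal_pdf2.
  exact: measurableT_comp.
by move=> p; rewrite lee_fin mulr_ge0// normal_pdf_ge0.
Qed.

Lemma gauss_conv (R : realType) (nu : {measure set R -> \bar R}) (m s b : R)
    (B : set R) :
  b != 0 -> measurable B ->
  (forall A, measurable A -> nu A = gauss m s A) ->
  (\int[nu]_y normal_prob 0 b [set v | B (y + v)%R] =
   normal_prob m (Num.sqrt (s ^+ 2 + b ^+ 2)) B)%E.
Proof.
move=> b0 mB nuE; set sg := Num.sqrt _.
have shiftE y : normal_prob 0 b [set v | B (y + v)] = normal_prob y b B.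
  have := gauss_affine 0 b 1 y mB; rewrite /gauss mulf_eq0 oner_eq0/= (negbTE b0).
  rewrite mulr0 add0r mul1r => <-; congr (normal_prob _ _ _).
  by apply/seteqP; split=> v /=; rewrite mul1r addrC.
under eq_integral do rewrite shiftE.
have mprob := measurable_normal_prob b0 mB.
move: nuE; rewrite /gauss; have [s0 nuE|s0 nuE] := eqVneq s 0.
  rewrite (eq_measure_integral (dirac m)); last by move=> A mA _; exact: nuE.
  rewrite integral_dirac// diracT mul1e /sg s0 expr0n/= add0r sqrtr_sqr.
  by rewrite normal_prob_abs.
pose f (p : R * R) := (normal_pdf m s p.1 * (normal_pdf p.1 b p.2 * \1_B p.2))%:E.
have mf : measurable_fun setT f.
  apply/measurable_EFinP; apply: measurable_funM.
    by apply: measurableT_comp => //; exact: measurable_normal_pdf.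
  apply: measurable_funM; first exact: measurable_normal_pdf2.
  exact: measurableT_comp.
have f0 p : (0 <= f p)%E.
  by rewrite lee_fin !mulr_ge0// normal_pdf_ge0.
have sg0 : sg != 0.
  by rewrite gt_eqF// sqrtr_gt0 ltr_wpDl ?sqr_ge0// exprn_even_gt0.
transitivity (\int[lebesgue_measure]_y
    (normal_prob y b B * (normal_pdf m s y)%:E))%E.
  (* The identity, seen as a map into the measurable type that carries [lebesgue_measure],
     transports [nu] there. *)
  have mid : measurable_fun [set: R] (idfun : R -> measurableTypeR R).
    by move=> _ A mA; rewrite setTI.
  have [nu' [nu'E nu'I]] := pushforward_measureP nu mid.
  transitivity (\int[nu']_y normal_prob y b B)%E.
    by apply/esym; apply: nu'I => // y; exact: measure_ge0.
  apply: (@ge0_integral_density _ _ R lebesgue_measure nu' (normal_pdf m s)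
    (fun y => normal_prob y b B)) => //.
  - exact: measurable_normal_pdf.
  - exact: normal_pdf_ge0.
  - by move=> A mA; rewrite nu'E nuE.
transitivity (\int[lebesgue_measure]_y \int[lebesgue_measure]_z f (y, z))%E.
  apply: eq_integral => y _; rewrite muleC /normal_prob integral_mkcond.
  rewrite -ge0_integralZl//; last 3 first.
  - apply/(measurable_restrictT _ _).1 => //; apply: measurable_funTS.
    by apply/measurable_EFinP; exact: measurable_normal_pdf.
  - by move=> z _; apply: erestrict_ge0 => t _; rewrite lee_fin normal_pdf_ge0.
  - by rewrite lee_fin normal_pdf_ge0.
  apply: eq_integral => z _; rewrite patchE /f /= indicE.
  by case: ifPn; rewrite ?mulr1 ?mulr0// ?mule0.
(* With [y] integrated first, [normal_pdf_mul] leaves the density of the sum. *)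
rewrite (@fubini_tonelli _ _ _ _ _ lebesgue_measure lebesgue_measure f)//.
rewrite /normal_prob [RHS]integral_mkcond.
apply: eq_integral => z _; rewrite patchE /f /=.
under eq_integral do rewrite mulrA normal_pdf_mul//.
case: ifPn => zB; rewrite indicE ?zB ?(negbTE zB).
  under eq_integral do rewrite mulr1 EFinM.
  rewrite ge0_integralZl//; last 3 first.
  - by apply/measurable_EFinP; exact: measurable_normal_pdf.
  - by move=> y _; rewrite lee_fin normal_pdf_ge0.
  - by rewrite lee_fin normal_pdf_ge0.
  by rewrite integral_normal_pdf mule1.
by under eq_integral do rewrite mulr0; rewrite integral0.
Qed.

(** The results on sections and product measures take a bundled finite measure; this rebundles a
    measure whose total mass is known to be finite. *)
Lemma finite_measureP d (S : measurableType d) (R : realType)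
    (nu : {measure set S -> \bar R}) : (nu setT < +oo)%E ->
  exists mu : {finite_measure set S -> \bar R}, forall A, mu A = nu A.
Proof.
move=> nuT; pose f : set S -> \bar R := Measure.sort nu.
have f0 : f set0 = 0%E by exact: measure0.
have f_ge0 A : (0 <= f A)%E by exact: measure_ge0.
have f_add : semi_sigma_additive f by exact: measure_semi_sigma_additive.
have f_fin : fin_num_fun f.
  move=> A mA; rewrite ge0_fin_numE//.
  by rewrite (le_lt_trans _ nuT)// le_measure ?inE.
pose M := isMeasure.Build _ _ _ f f0 f_ge0 f_add.
pose M0 : {measure set S -> \bar R} := HB.pack f M.
pose FM := Measure_isFinite.Build _ _ _ M0 f_fin.
by unshelve eexists (HB.pack f M FM : {finite_measure set S -> \bar R}).
Qed.

(** Restricted to [F], the pair (Y, V) has as law the product of the law of [Y] and the restricted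
    law of [V], because the two measures agree on rectangles. The event [F] goes with [V] since it
    will be an event about the paths of J. *)
Lemma indep_integral d d1 (Omega : measurableType d) (R : realType)
    (P : probability Omega R) (S1 : measurableType d1)
    (Y : {mfun Omega >-> S1}) (V : {mfun Omega >-> R}) (F : set Omega) :
  measurable F ->
  (forall A B, measurable A -> measurable B ->
    P (Y @^-1` A `&` (F `&` V @^-1` B)) = (P (Y @^-1` A) * P (F `&` V @^-1` B))%E) ->
  forall E : set (S1 * R), measurable E ->
    P (F `&` [set w | E (Y w, V w)]) =
    (\int[distribution P Y]_y P (F `&` V @^-1` xsection E y))%E /\
    measurable_fun setT (fun y => P (F `&` V @^-1` xsection E y)).
Proof.
move=> mF H E mE.
have [nu [nuE _]] := pushforward_measureP (mrestr P mF) (measurable_funPT V).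
have {}nuE A : nu A = P (F `&` V @^-1` A) by rewrite nuE /mrestr /= setIC.
have nuT : (nu setT < +oo)%E.
  by rewrite nuE preimage_setT setIT ltey_eq fin_num_measure.
have [m2 m2E] := finite_measureP nuT.
split; last first.
  have := @measurable_fun_xsection _ _ _ _ R m2 _ mE.
  by apply: eq_measurable_fun => y _; rewrite /= m2E nuE.
have mYV : measurable_fun setT (fun w => (Y w, V w)).
  exact: measurable_fun_pair.
have [m' [m'E _]] := pushforward_measureP (mrestr P mF) mYV.
have {}m'E A : m' A = P (F `&` [set w | A (Y w, V w)]) by rewrite m'E /mrestr /= setIC.
rewrite -m'E -(@product_measure_unique _ _ _ _ R (distribution P Y) m2)//.
  by rewrite /product_measure1/=; apply: eq_integral => y _; rewrite /= m2E nuE.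
move=> A B mA mB; rewrite m'E /= m2E nuE -H//; congr (P _).
by apply/seteqP; split => w /= [? []].
Qed.

Section independent_sum.
Context d (Omega : measurableType d) (R : realType) (P : probability Omega R)
  (Y V : {RV P >-> R}) (F : set Omega) (m s b : R) (p : \bar R).
Hypotheses (mF : measurable F) (b0 : b != 0) (p0 : (0 <= p)%E)
  (Y_gauss : has_law P Y (gauss m s)).
Hypothesis indep : forall A B, measurable A -> measurable B ->
  P (Y @^-1` A `&` (F `&` V @^-1` B)) = (P (Y @^-1` A) * P (F `&` V @^-1` B))%E.

Let sumset (B : set R) : set (R * R) := [set z | B (z.1 + z.2)].

Let measurable_sumset B : measurable B -> measurable (sumset B).
Proof.
move=> mB; rewrite -[X in measurable X]setTI.
have mD : measurable_fun setT (fun z : R * R => z.1 + z.2).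
  exact: measurable_funD.
exact: mD.
Qed.

Let xsection_sumset B y : xsection (sumset B) y = [set v | B (y + v)].
Proof. by apply/seteqP; split=> v /=; rewrite /xsection /= inE. Qed.

Let measurable_shift B y : measurable B -> measurable [set v : R | B (y + v)].
Proof.
move=> mB; rewrite -xsection_sumset.
by apply: measurable_xsection; exact: measurable_sumset.
Qed.

Let law_sum B : measurable B ->
  (\int[distribution P Y]_y (p * normal_prob 0 b [set v | B (y + v)%R]) =
   p * normal_prob m (Num.sqrt (s ^+ 2 + b ^+ 2)) B)%E.
Proof.
move=> mB; rewrite ge0_integralZl//; last first.
  have := @measurable_fun_xsection _ _ _ _ R (normal_prob 0 b) _ (measurable_sumset mB).
  by apply: eq_measurable_fun => y _; rewrite /= xsection_sumset.
by congr (_ * _)%E; apply: gauss_conv => // A mA; exact: Y_gauss.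
Qed.

Let measurable_law_sum B : measurable B ->
  measurable_fun setT (fun y : R => p * normal_prob 0 b [set v | B (y + v)%R])%E.
Proof.
move=> mB; apply: measurable_funeM.
have := @measurable_fun_xsection _ _ _ _ R (normal_prob 0 b) _ (measurable_sumset mB).
by apply: eq_measurable_fun => y _; rewrite /= xsection_sumset.
Qed.

(** The law of [V] on [F] need not be Gaussian; it is enough that [p] times a Gaussian law dominates
    it, since integrating against the law of [Y] preserves the inequality. In the application [p] is
    the probability of a larger event, on which [V] is exactly Gaussian. *)
Lemma indep_gauss_sum_le B : measurable B ->
  (forall A, measurable A -> P (F `&` V @^-1` A) <= p * normal_prob 0 b A)%E ->
  (P (F `&` [set w | B (Y w + V w)%R]) <=
   p * normal_prob m (Num.sqrt (s ^+ 2 + b ^+ 2)) B)%E.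
Proof.
move=> mB leV; have [-> mP] := indep_integral mF indep (measurable_sumset mB).
rewrite -law_sum//; apply: ge0_le_integral => //; first exact: measurable_law_sum.
by move=> y _; rewrite xsection_sumset; apply: leV; exact: measurable_shift.
Qed.

Lemma indep_gauss_sum_ge B : measurable B ->
  (forall A, measurable A -> p * normal_prob 0 b A <= P (F `&` V @^-1` A))%E ->
  (p * normal_prob m (Num.sqrt (s ^+ 2 + b ^+ 2)) B <=
   P (F `&` [set w | B (Y w + V w)%R]))%E.
Proof.
move=> mB leV; have [-> mP] := indep_integral mF indep (measurable_sumset mB).
rewrite -law_sum//; apply: ge0_le_integral => //.
- by move=> y _; exact: mule_ge0.
- exact: measurable_law_sum.
- by move=> y _; rewrite xsection_sumset; apply: leV; exact: measurable_shift.
Qed.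

End independent_sum.

Lemma indep_gauss_sum d (Omega : measurableType d) (R : realType)
    (P : probability Omega R) (Y V : {RV P >-> R}) (F : set Omega)
    (m s b : R) (B : set R) :
  measurable F -> b != 0 -> has_law P Y (gauss m s) ->
  (forall A B, measurable A -> measurable B ->
    P (Y @^-1` A `&` (F `&` V @^-1` B)) =
    (P (Y @^-1` A) * P (F `&` V @^-1` B))%E) ->
  (forall A, measurable A -> P (F `&` V @^-1` A) = P F * normal_prob 0 b A)%E ->
  measurable B ->
  (P (F `&` [set w | B (Y w + V w)%R]) =
   P F * normal_prob m (Num.sqrt (s ^+ 2 + b ^+ 2)) B)%E.
Proof.
move=> mF b0 YE indep VE mB; apply/eqP; rewrite eq_le; apply/andP; split.
- by apply: (indep_gauss_sum_le mF b0 _ YE) => // A mA; rewrite VE.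
- by apply: (indep_gauss_sum_ge mF b0 _ YE) => // A mA; rewrite VE.
Qed.

Lemma measurable_ar_chain d (Omega : measurableType d) (R : realType) (rho : R)
    (eps : nat -> Omega -> R) (n : nat) :
  (forall i, measurable_fun setT (eps i)) ->
  measurable_fun setT (ar_chain rho eps n).
Proof.
move=> meps; elim: n => [|n IHn]; first exact: meps.
by apply: measurable_funD; apply: measurable_funM.
Qed.

Lemma bigcap_seq_cons (T : Type) (i : nat) (s : seq nat) (A : nat -> set T) :
  \bigcap_(j in [set` i :: s]) A j = A i `&` \bigcap_(j in [set` s]) A j.
Proof.
apply/seteqP; split => x.
  by move=> h; split => [|j js]; apply: h; rewrite /= ?inE ?eqxx//; rewrite js orbT.
by move=> [hi hs] j; rewrite /= inE => /predU1P[->//|]; exact: hs.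
Qed.

(** * The auto-regressive chain and the Poisson clock *)

Section ar_chain_law.
Context d (Omega : measurableType d) (R : realType) (P : probability Omega R)
  (rho : R) (eps : nat -> {RV P >-> R}) (sg : R).
Hypotheses (rho_lt1 : `|rho| < 1) (sg_gt0 : 0 < sg)
  (eps_iid : iid_with_law P eps (normal_prob 0 sg)).

Let measurable_capF (s : seq nat) (B : nat -> set R) :
  (forall i, measurable (B i)) ->
  measurable (\bigcap_(i in [set` s]) eps i @^-1` B i).
Proof.
move=> mB; apply: fin_bigcap_measurable => // i _.
by rewrite -[X in measurable X]setTI; exact: measurable_funPT.
Qed.

Let normal_scale (c : R) (A : set R) : measurable A -> c != 0 ->
  normal_prob 0 sg [set x | A (c * x)] = normal_prob 0 (c * sg) A.
Proof.
move=> mA c0; have := gauss_affine 0 sg c 0 mA.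
rewrite /gauss mulf_eq0 (gt_eqF sg_gt0) (negbTE c0)/= mulr0 add0r => <-.
by congr (normal_prob _ _ _); apply/seteqP; split => x /=; rewrite addr0.
Qed.

(** The induction has to carry the future innovations along, as the next step needs
    [ar_chain rho eps n] to be independent of [eps n.+1]. The law is stationary because rho^2 + (1 -
    rho^2) = 1. *)
Lemma ar_chain_joint_law (n : nat) (s : seq nat) (B : nat -> set R) (C : set R) :
  uniq s -> (forall i, i \in s -> (n < i)%N) ->
  (forall i, measurable (B i)) -> measurable C ->
  P (ar_chain rho eps n @^-1` C `&` \bigcap_(i in [set` s]) eps i @^-1` B i) =
  (normal_prob 0 sg C * \prod_(i <- s) P (eps i @^-1` B i))%E.
Proof.
have [indep law] := eps_iid.
elim: n s B C => [|n IHn] s B C us sn mB mC.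
  pose B' i := if i == 0%N then C else B i.
  have B'E i : i \in s -> B' i = B i.
    by move=> /sn; rewrite lt0n /B' => /negbTE ->.
  have := indep (0%N :: s) B'; rewrite bigcap_seq_cons big_cons.
  have -> : \bigcap_(i in [set` s]) eps i @^-1` B' i =
      \bigcap_(i in [set` s]) eps i @^-1` B i.
    by apply: eq_bigcapr => i is_; rewrite B'E.
  have -> : (\prod_(i <- s) P (eps i @^-1` B' i) =
      \prod_(i <- s) P (eps i @^-1` B i))%E.
    by apply: eq_big_seq => i is_; rewrite B'E.
  rewrite {1 3}/B' eqxx => ->; first by rewrite law.
  - rewrite /= us andbT; apply/negP => /sn; by rewrite ltnn.
  - by move=> i; rewrite /B'; case: ifP.
set F := \bigcap_(i in _) _; set c := Num.sqrt (1 - rho ^+ 2).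
have rho2 : rho ^+ 2 < 1.
  by rewrite -real_normK ?num_real// exprn_ilt1// ?normr_ge0.
have c0 : c != 0 by rewrite gt_eqF// sqrtr_gt0 subr_gt0.
have meps i : measurable_fun setT (eps i : Omega -> R) by [].
have mY : measurable_fun setT (fun w => rho * ar_chain rho eps n w).
  by apply: measurable_funM => //; exact: measurable_ar_chain.
have mV : measurable_fun setT (fun w => c * eps n.+1 w).
  exact: measurable_funM.
pose Y : {RV P >-> R} := mfun_Sub (mem_set mY).
pose V : {RV P >-> R} := mfun_Sub (mem_set mV).
have mscale (a : R) (A : set R) : measurable A -> measurable [set x | A (a * x)].
  move=> mA; rewrite -[X in measurable X]setTI.
  have ma : measurable_fun setT (fun x : R => a * x) by exact: measurable_funM.
  exact: ma.
have us' : uniq (n.+1 :: s).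
  by rewrite /= us andbT; apply/negP => /sn; rewrite ltnn.
(* Constraining [eps n.+1] together with the innovations in [s] turns events about [V] and [F] into
   instances of the induction hypothesis. *)
pose B' A i := if i == n.+1 then [set x | A (c * x)] else B i.
have mB' A : measurable A -> forall i, measurable (B' A i).
  by move=> mA i; rewrite /B'; case: ifP => _ //; exact: mscale.
have B'E A i : i \in s -> B' A i = B i.
  by rewrite /B'; case: eqP => // -> /sn; rewrite ltnn.
have B'cap A : \bigcap_(i in [set` n.+1 :: s]) eps i @^-1` B' A i =
    F `&` V @^-1` A.
  rewrite bigcap_seq_cons setIC; congr (_ `&` _); last first.
    by rewrite /B' eqxx.
  by apply: eq_bigcapr => i is_; rewrite B'E.
have B'prod A : measurable A ->
    (\prod_(i <- n.+1 :: s) P (eps i @^-1` B' A i) =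
    normal_prob 0 (c * sg) A * \prod_(i <- s) P (eps i @^-1` B i))%E.
  move=> mA; rewrite big_cons; congr (_ * _)%E.
    by rewrite /B' eqxx law ?normal_scale//; exact: mscale.
  by apply: eq_big_seq => i is_; rewrite B'E.
have PFV A : measurable A ->
    P (F `&` V @^-1` A) = (P F * normal_prob 0 (c * sg) A)%E.
  move=> mA; rewrite -B'cap indep//; last exact: mB'.
  by rewrite B'prod// muleC indep.
have PY A : measurable A -> P (Y @^-1` A) = normal_prob 0 sg [set x | A (rho * x)].
  move=> mA; have := IHn [::] B [set x | A (rho * x)].
  rewrite big_nil mule1 => <- //; last exact: mscale.
  rewrite (_ : [set` [::]] = set0) ?bigcap_set0 ?setIT//.
  by apply/seteqP; split.
have -> : ar_chain rho eps n.+1 @^-1` C `&` F =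
    F `&` [set w | C (Y w + V w)] by rewrite setIC.
have sqrtE : Num.sqrt ((rho * sg) ^+ 2 + (c * sg) ^+ 2) = sg.
  rewrite !exprMn -mulrDl sqr_sqrtr ?subr_ge0 ?ltW//.
  by rewrite addrC subrK mul1r sqrtr_sqr gtr0_norm.
rewrite (@indep_gauss_sum _ _ _ P Y V F 0 (rho * sg) (c * sg))//.
- by rewrite sqrtE indep// muleC.
- exact: measurable_capF.
- by rewrite mulf_neq0// gt_eqF.
- move=> A mA; rewrite PY//.
  have := gauss_affine 0 sg rho 0 mA.
  rewrite {1}/gauss (gt_eqF sg_gt0) mulr0 add0r => <-.
  by congr (normal_prob _ _ _); apply/seteqP; split => x /=; rewrite addr0.
- move=> A A' mA mA'; rewrite -B'cap.
  have -> : Y @^-1` A = ar_chain rho eps n @^-1` [set x | A (rho * x)] by [].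
  rewrite IHn//; last 3 first.
  - by move=> i; rewrite inE => /predU1P[->//|/sn]; exact: ltnW.
  - exact: mB'.
  - exact: mscale.
  by rewrite -PY// indep//; exact: mB'.
Qed.

Lemma ar_chain_law (n : nat) : has_law P (ar_chain rho eps n) (normal_prob 0 sg).
Proof.
move=> C mC; have := @ar_chain_joint_law n [::] (fun=> setT) C.
rewrite big_nil mule1 => <- //.
rewrite (_ : [set` [::]] = set0) ?bigcap_set0 ?setIT//.
by apply/seteqP; split.
Qed.

End ar_chain_law.

(** * Counting functions of jump epochs *)

Lemma near_finite (U : Type) (I : choiceType) (F : set_system U) {FF : Filter F}
    (D : set I) (Q : I -> U -> Prop) :
  finite_set D -> (forall n, D n -> \forall t \near F, Q n t) ->
  \forall t \near F, forall n, D n -> Q n t.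
Proof.
move=> finD FQ; have := @filter_bigI U I (fset_set D) Q F FF.
move=> /(_ _)/filterS; apply.
  by move=> t h n Dn; apply: h; rewrite /= in_fset_set// inE.
by move=> n; rewrite in_fset_set// inE; exact: FQ.
Qed.

Section counting_function.
Context (R : realType) (S : nat -> R) (nu : R -> nat).
Hypothesis nuP : forall t, 0 <= t -> ([set n | S n <= t] #= `I_(nu t))%card.

Let finite_epochs t : 0 <= t -> finite_set [set n | S n <= t].
Proof. by move=> /nuP ?; apply/finite_setP; exists (nu t). Qed.

Let nu_eq s t : 0 <= s -> 0 <= t ->
  [set n | S n <= s] = [set n | S n <= t] -> nu s = nu t.
Proof.
move=> /nuP hs /nuP ht E; apply/card_eq_II.
by rewrite card_eq_sym in hs; apply: (card_eq_trans hs); rewrite E.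
Qed.

Lemma counting_fun_mono s t : 0 <= s -> s <= t -> (nu s <= nu t)%N.
Proof.
move=> s0 st; have t0 := le_trans s0 st.
rewrite -card_le_II; have /card_eqPle[_ sle] := nuP s0.
apply: (card_le_trans sle); have /card_eqPle[tle _] := nuP t0.
apply: card_le_trans tle; apply: subset_card_le => n /= /le_trans; exact.
Qed.

(** Only finitely many epochs are at most [t + 1], so those beyond [t] stay at a positive distance
    from it. *)
Lemma counting_fun_right t : 0 <= t -> \forall t' \near t^'+, nu t' = nu t.
Proof.
move=> t0; have t10 : 0 <= t + 1 by rewrite addr_ge0.
have near1 : \forall t' \near t^'+, forall n, S n <= t + 1 -> t < S n -> t' < S n.
  apply: near_finite => [|n _]; first exact: finite_epochs.
  have [St|tS] := leP (S n) t; first by near=> t'.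
  by near=> t' => _; near: t'; exact: nbhs_right_lt.
near=> t'.
have tt' : t < t' by near: t'; exact: nbhs_right_gt.
have t'1 : t' <= t + 1 by near: t'; apply: nbhs_right_le; rewrite ltrDl.
apply: nu_eq => //; first by rewrite (le_trans t0)// ltW.
apply/seteqP; split => n /= Sn; last by rewrite (le_trans Sn)// ltW.
rewrite leNgt; apply/negP => tS.
suff : t' < S n by rewrite ltNge Sn.
by move: n {Sn}(le_trans Sn t'1) tS; near: t'.
Unshelve. all: by end_near. Qed.

(** The left limit is an unspecified [k], since [t] may itself be an epoch; what matters is that
    epochs do not accumulate from the left. *)
Lemma counting_fun_left t : 0 < t ->
  exists k, \forall t' \near t^'-, nu t' = k.
Proof.
move=> t0.
have near1 : \forall t' \near t^'-, forall n, S n <= t -> S n < t -> S n <= t'.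
  apply: near_finite => [|n _]; first exact/finite_epochs/ltW.
  have [tS|St] := leP t (S n); first by near=> t'.
  by near=> t' => _; near: t'; exact: nbhs_left_ge.
have near2 : \forall t' \near t^'-, 0 <= t' /\
    [set n | S n <= t'] = [set n | S n < t].
  near=> t'.
  have t't : t' < t by near: t'; exact: nbhs_left_lt.
  split; first by near: t'; exact: nbhs_left_ge.
  apply/seteqP; split => n /= Sn; first exact: le_lt_trans Sn t't.
  have St := ltW Sn.
  by move: n St Sn; near: t'.
have [t1 [t10 E1]] := filter_ex near2.
exists (nu t1); apply: filterS near2 => t2 [t20 E2].
by apply: nu_eq => //; rewrite E2.
Unshelve. all: by end_near. Qed.

(** As a series of indicators the counter becomes measurable, and integrable term by term. *)
Lemma counting_fun_series t : 0 <= t ->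
  (nu t)%:R%:E = (\sum_(n <oo) (\1_[set n | S n <= t] n)%:E)%E :> \bar R.
Proof.
move=> t0; have fin := finite_epochs t0.
have -> : (\sum_(n <oo) (\1_[set n | S n <= t] n)%:E =
    counting [set n | (S n <= t)%R] :> \bar R)%E.
  by rewrite counting_dirac; apply: eq_eseriesr => n _.
rewrite /counting asboolT//; congr (_%:R%:E); apply/esym/card_eq_fsetP.
by rewrite fset_setK//; exact: nuP.
Qed.

End counting_function.

Lemma exponential_prob_lt0 (R : realType) (lambda : R) :
  exponential_prob lambda `]-oo, 0[ = 0%E.
Proof.
apply: integral0_eq => x; rewrite /= in_itv/= => x0.
by rewrite lt0_exponential_pdf.
Qed.

Lemma exponential_prob_le (R : realType) (lambda t : R) : 0 < lambda -> 0 < t ->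
  exponential_prob lambda `]-oo, t] = (1 - expR (- lambda * t))%:E.
Proof.
move=> l0 t0.
have -> : `]-oo, t]%classic = `]-oo, 0[%classic `|` `[0, t]%classic :> set R.
  apply/seteqP; split => x /=; rewrite !in_itv/=.
    by move=> ->; rewrite andbT; apply/orP; rewrite orbC leNgt orNb.
  by case=> [x0|/andP[]//]; rewrite (le_trans (ltW x0))// ltW.
rewrite (measureU (exponential_prob lambda)).
- rewrite EFinB -[RHS]add0e; congr (_ + _)%E; first exact: exponential_prob_lt0.
  exact: exponential_prob_itv0c.
- exact: measurable_itv.
- exact: measurable_itv.
- apply/seteqP; split => x //=; rewrite !in_itv/= => -[x0 /andP[+ _]].
  by rewrite leNgt x0.
Qed.

Section poisson.
Context d (Omega : measurableType d) (R : realType) (P : probability Omega R)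
  (lambda : R) (W : nat -> {RV P >-> R}) (nu : R -> Omega -> nat).
Hypotheses (lambda_gt0 : 0 < lambda)
  (W_iid : iid_with_law P W (exponential_prob lambda))
  (nuP : forall (t : R) (w : Omega), 0 <= t ->
      ([set n | (\sum_(i < n.+1) W i w <= t)%R] #= `I_(nu t w))%card).

Let epoch n w := \sum_(i < n.+1) W i w.

Let measurable_epoch n : measurable_fun setT (epoch n).
Proof. exact: measurable_sum. Qed.

Let measurable_epoch_le n t : measurable [set w | epoch n w <= t].
Proof.
rewrite -[X in measurable X]setTI.
have := measurable_epoch n; move=> /(_ measurableT `]-oo, t]%classic).
move=> /(_ (measurable_itv _)); congr (measurable (_ `&` _)).
Qed.

Let nu_series t w : 0 <= t ->
  (nu t w)%:R%:E = (\sum_(n <oo) (\1_[set w | epoch n w <= t] w)%:E)%E :> \bar R.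
Proof.
move=> t0; rewrite (counting_fun_series (nuP^~ w) t0).
by apply: eq_eseriesr => n _; congr (_%:E); rewrite !indicE; congr (_%:R).
Qed.

Lemma measurable_poisson t : 0 <= t ->
  measurable_fun setT (fun w => (nu t w)%:R%:E : \bar R).
Proof.
move=> t0; under eq_fun do rewrite nu_series//.
apply: ge0_emeasurable_sum => n; first by move=> w _ _; rewrite lee_fin.
by move=> _; apply/measurable_EFinP; exact: measurable_indic.
Qed.

(** Exponential waiting times are nonnegative only almost surely, and a negative one would make the
    epochs non-monotone. The offending paths form a null event, which is added to the larger side of
    the inclusions below. *)
Let neg := \bigcup_i [set w | W i w < 0].

Let measurable_neg_i i : measurable [set w | W i w < 0].
Proof.
rewrite -[X in measurable X]setTI.
have := measurable_funPT (W i); move=> /(_ measurableT `]-oo, 0[%classic).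
move=> /(_ (measurable_itv _)); congr (measurable (_ `&` _)).
Qed.

Let measurable_neg : measurable neg.
Proof. exact: bigcup_measurable. Qed.

Let P_neg : P neg = 0%E.
Proof.
apply: measure_negligible => //; apply: negligible_bigcup => i.
apply/negligibleP => //; transitivity (P (W i @^-1` `]-oo, 0[)).
  by congr (P _).
by rewrite (W_iid.2 i)// exponential_prob_lt0.
Qed.

Let notin_neg w : ~ neg w -> forall i, 0 <= W i w.
Proof. by move=> Nw i; rewrite leNgt; apply/negP => Ww; apply: Nw; exists i. Qed.

Let W_le_epoch w n i : ~ neg w -> (i <= n)%N -> W i w <= epoch n w.
Proof.
move=> /notin_neg W0 i_n; rewrite /epoch (bigD1 (Ordinal (i_n : (i < n.+1)%N)))//=.
by rewrite lerDl sumr_ge0.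
Qed.

Let P_W_le i t : 0 < t ->
  P (W i @^-1` `]-oo, t]) = (1 - expR (- lambda * t))%:E.
Proof.
move=> t0; rewrite (W_iid.2 i); last exact: measurable_itv.
exact: exponential_prob_le.
Qed.

(** If the first waiting time exceeds [t] and none is negative, there is no epoch up to [t]; this
    has probability exp(- lambda t). *)
Lemma poisson_no_jump t : 0 < t -> (0 < P [set w | nu t w = nu 0 w])%E.
Proof.
move=> t0; have t0' := ltW t0.
have mE : measurable [set w | nu t w = nu 0 w].
  have := measurable_poisson t0'; have := measurable_poisson (lexx 0).
  move=> m0 mt; have := emeasurable_fun_eq measurableT mt m0.
  rewrite setTI; congr (measurable _); apply/seteqP; split => w /=.
    by move=> [/eqP]; rewrite eqr_nat => /eqP.
  by move=> ->.
have Wpos : (0 < P (W 0%N @^-1` `]t, +oo[))%E.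
  have -> : W 0%N @^-1` `]t, +oo[ = ~` (W 0%N @^-1` `]-oo, t]).
    by rewrite preimage_setC setCitvl.
  rewrite probability_setC; last first.
    exact: measurable_funPTI.
  by rewrite P_W_le// -EFinB lte_fin opprB addrC subrK expR_gt0.
have mW : measurable (W 0%N @^-1` `]t, +oo[).
  exact: measurable_funPTI.
have sub : W 0%N @^-1` `]t, +oo[ `<=` [set w | nu t w = nu 0 w] `|` neg.
  move=> w /=; rewrite in_itv/= andbT => tW.
  have [Nw|Nw] := pselect (neg w); [by right|left].
  have E s : 0 <= s -> s <= t -> nu s w = 0%N.
    move=> s0 st; apply/card_eq_II; rewrite II0 card_eq_sym.
    rewrite (_ : set0 = [set n | (\sum_(i < n.+1) W i w <= s)%R]) ?nuP//.
    apply/esym/seteqP; split => n //= Sn.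
    have := le_trans (W_le_epoch Nw (leq0n n)) (le_trans Sn st).
    by rewrite leNgt tW.
  by rewrite !E.
have := le_measure P _ _ sub; rewrite !inE => /(_ mW).
move=> /(_ (measurableU _ _ mE measurable_neg)).
move=> /le_trans/(_ (measureU2 _ mE measurable_neg)).
rewrite [X in (_ <= _ + X)%E -> _]P_neg adde0; apply: lt_le_trans.
exact: Wpos.
Qed.

(** A sum of [n.+1] nonnegative terms is at most [t] only if each of them is. This geometric bound
    replaces the exact law of the epoch and is summable. *)
Let P_epoch_le t n : 0 < t ->
  (P [set w | (epoch n w <= t)%R] <= ((1 - expR (- lambda * t)) ^+ n.+1)%:E)%E.
Proof.
move=> t0; set q := 1 - _; pose B (i : nat) : set R := `]-oo, t]%classic.
have mB i : measurable (B i) by exact: measurable_itv.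
pose A := \bigcap_(i in [set` iota 0 n.+1]) W i @^-1` B i.
have mA : measurable A.
  apply: fin_bigcap_measurable => // i _.
  exact: measurable_funPTI.
have PA : P A = (q ^+ n.+1)%:E.
  rewrite W_iid.1 ?iota_uniq//.
  under eq_bigr do rewrite P_W_le//.
  by rewrite prodEFin big_const_seq count_predT size_iota iter_mulr mulr1.
have sub : [set w | epoch n w <= t] `<=` A `|` neg.
  move=> w /= Sn; have [Nw|Nw] := pselect (neg w); [by right|left].
  move=> i i_in; have : i \in iota 0 n.+1 by [].
  rewrite mem_iota add0n => /andP[_ i_n].
  by rewrite /B/= in_itv/= (le_trans _ Sn)// W_le_epoch.
have := le_measure P _ _ sub; rewrite !inE => /(_ (measurable_epoch_le n t)).
move=> /(_ (measurableU _ _ mA measurable_neg)) /le_trans; apply.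
apply: (le_trans (measureU2 _ mA measurable_neg)).
by rewrite [X in (_ + X <= _)%E]P_neg adde0 [leLHS]PA.
Qed.

Lemma poisson_integrable t : 0 < t ->
  (\int[P]_w (nu t w)%:R%:E < +oo)%E.
Proof.
move=> t0; have t0' := ltW t0.
under eq_integral do rewrite nu_series//.
rewrite integral_nneseries//; last first.
  by move=> n; apply/measurable_EFinP; exact: measurable_indic.
under eq_eseriesr do rewrite integral_indic// setIT.
set q := 1 - expR (- lambda * t).
have q1 : 0 < 1 - q by rewrite opprB addrC subrK expR_gt0.
have q0 : 0 <= q.
  by rewrite subr_ge0 -expR0 ler_expR mulNr oppr_le0 mulr_ge0// ltW.
(* Every partial sum of the geometric series is at most [(1 - q)^-1], because multiplication by
   [1 - q] telescopes it to [q - q ^+ m.+1], which is at most 1. *)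
apply: (@le_lt_trans _ _ ((1 - q)^-1)%:E); last exact: ltry.
apply: lime_le; first by apply: is_cvg_nneseries => n _ _; exact: measure_ge0.
apply: nearW => m.
have /le_trans : (\sum_(0 <= n < m) P [set w | (epoch n w <= t)%R] <=
    \sum_(0 <= n < m) (q ^+ n.+1)%:E)%E by apply: lee_sum => n _; exact: P_epoch_le.
apply; rewrite sumEFin lee_fin -[leRHS]mul1r ler_pdivlMr// mulrC.
have -> : (1 - q) * (\sum_(0 <= n < m) q ^+ n.+1) = q - q ^+ m.+1.
  elim: m => [|m IHm]; first by rewrite big_geq// mulr0 expr1 subrr.
  by rewrite big_nat_recr//= mulrDr IHm (exprS q m.+1); ring.
by rewrite lerBlDr -subr_ge0 addrAC addr_ge0// ?exprn_ge0// ltW.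
Qed.

End poisson.

(** * Sigma-algebras generated by processes *)

Section sigma_process.
Context d d' (Omega : measurableType d) (S : measurableType d') (I : Type)
  (D : set I) (Y : I -> Omega -> S).

Let G := \bigcup_(i in D) preimage_set_system setT (Y i) measurable.

Lemma sigma_process_preimage i B : D i -> measurable B ->
  sigma_process D Y (Y i @^-1` B).
Proof.
move=> Di mB; apply: sub_sigma_algebra; exists i => //; exists B => //.
by rewrite setTI.
Qed.

Lemma sigma_process_setI A B : sigma_process D Y A -> sigma_process D Y B ->
  sigma_process D Y (A `&` B).
Proof. exact: (@measurableI _ (g_sigma_algebraType G)). Qed.

Lemma sigma_process_setC A : sigma_process D Y A -> sigma_process D Y (~` A).
Proof. exact: (@measurableC _ (g_sigma_algebraType G)). Qed.

Lemma sigma_process_bigcup (A : nat -> set Omega) :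
  (forall n, sigma_process D Y (A n)) -> sigma_process D Y (\bigcup_n A n).
Proof.
by move=> h; apply: (@bigcup_measurable _ (g_sigma_algebraType G)) => n _; exact: h.
Qed.

Lemma sigma_process_bigcap (A : nat -> set Omega) :
  (forall n, sigma_process D Y (A n)) -> sigma_process D Y (\bigcap_n A n).
Proof.
by move=> h; apply: (@bigcapT_measurable _ (g_sigma_algebraType G)) => n; exact: h.
Qed.

Lemma sigma_process_measurable_fun i : D i ->
  measurable_fun [set: g_sigma_algebraType G] (Y i : g_sigma_algebraType G -> S).
Proof. by move=> Di _ B mB; rewrite setTI; exact: sigma_process_preimage. Qed.

Lemma sigma_process_measurable A :
  (forall i, D i -> measurable_fun setT (Y i)) ->
  sigma_process D Y A -> measurable A.
Proof.
move=> mY; apply: smallest_sub; first exact: sigma_algebra_measurable.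
by move=> _ [i Di [B mB <-]]; exact: mY.
Qed.

End sigma_process.

Section PAR_law.
Context d (Omega : measurableType d) (R : realType) (P : probability Omega R)
  (rho sg : R) (eps : nat -> {RV P >-> R}) (nu : R -> Omega -> nat).
Hypotheses (rho_lt1 : `|rho| < 1) (sg_gt0 : 0 < sg)
  (eps_iid : iid_with_law P eps (normal_prob 0 sg))
  (mnu : forall t, 0 <= t -> measurable_fun setT (nu t))
  (nu_eps : independent_systems P (sigma_process `[0, +oo[ nu)
                                  (sigma_process setT eps)).

Lemma ar_chain_sigma n (B : set R) : measurable B ->
  sigma_process setT eps (ar_chain rho eps n @^-1` B).
Proof.
move=> mB; have meps i := @sigma_process_measurable_fun _ _ _ _ _ setT eps i Logic.I.
by have := measurable_ar_chain rho n meps measurableT mB; rewrite setTI.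
Qed.

Lemma sigma_nu_measurable H : sigma_process `[0, +oo[ nu H -> measurable H.
Proof.
apply: sigma_process_measurable => t /=; rewrite in_itv/= andbT; exact: mnu.
Qed.

(** Split according to the value n of [nu t]: each part of [H] belongs to the sigma-algebra of [nu],
    hence is independent of the chain, and the law of the n-th state does not depend on n. The event
    [H] may involve the whole path of [nu]. *)
Lemma PAR_law (t : R) (H : set Omega) (B : set R) :
  0 <= t -> sigma_process `[0, +oo[ nu H -> measurable B ->
  P (H `&` [set w | B (ar_chain rho eps (nu t w) w)]) =
  (P H * normal_prob 0 sg B)%E.
Proof.
move=> t0 sH mB; pose Hn n := H `&` nu t @^-1` [set n].
have tD : t \in `[0, +oo[ by rewrite in_itv/= t0.
have sHn n : sigma_process `[0, +oo[ nu (Hn n).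
  by apply: sigma_process_setI => //; exact: sigma_process_preimage.
have mHn n : measurable (Hn n) by exact: sigma_nu_measurable.
have mA n : measurable (ar_chain rho eps n @^-1` B).
  apply: sigma_process_measurable (ar_chain_sigma n mB) => i _.
  exact: measurable_funPT.
have tHn : trivIset setT Hn.
  apply/trivIsetP => i j _ _ /eqP ij; apply/seteqP; split => w //=.
  by move=> [[_ wi] [_ wj]]; apply: ij; rewrite -wi -wj.
have -> : H `&` [set w | B (ar_chain rho eps (nu t w) w)] =
    \bigcup_n (Hn n `&` ar_chain rho eps n @^-1` B).
  apply/seteqP; split => w /=; first by move=> [Hw Bw]; exists (nu t w).
  by move=> [n _ [[Hw <-] Bw]].
rewrite measure_bigcup//=; last 2 first.
- by move=> n _; exact: measurableI.
- exact: trivIset_setIr.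
have PHn n : P (Hn n `&` ar_chain rho eps n @^-1` B) =
    (normal_prob 0 sg B * P (Hn n))%E.
  rewrite nu_eps//; last exact: ar_chain_sigma.
  by rewrite (ar_chain_law rho_lt1 sg_gt0 eps_iid)// muleC.
have Bfin : normal_prob 0 sg B \is a fin_num.
  exact: (fin_num_measure (normal_prob 0 sg)).
rewrite -(fineK Bfin) in PHn *.
under eq_eseriesr do rewrite PHn.
rewrite nneseriesZl//.
rewrite muleC; congr (_ * _)%E; rewrite -measure_bigcup//; congr (P _).
apply/seteqP; split => w /=; first by move=> [n _ []].
by move=> Hw; exists (nu t w).
Qed.

End PAR_law.

Lemma poisson_measurable d (Omega : measurableType d) (R : realType)
    (P : probability Omega R) (lambda : R) (nu : R -> Omega -> nat) (t : R) :
  poisson_process P lambda nu -> 0 <= t -> measurable_fun setT (nu t).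
Proof.
move=> [W [_ nuP]] t0 _ B _; rewrite setTI.
have -> : nu t @^-1` B = \bigcup_(n in B) [set w | (nu t w)%:R%:E = n%:R%:E :> \bar R].
  apply/seteqP; split => w /=; first by move=> Bw; exists (nu t w).
  by move=> [n Bn [/eqP]]; rewrite eqr_nat => /eqP ->.
apply: bigcup_measurable => n _; rewrite -[X in measurable X]setTI.
by apply: emeasurable_fun_eq => //; exact: (measurable_poisson nuP).
Qed.

Section jump_process.
Context d (Omega : measurableType d) (R : realType) (P : probability Omega R)
  (rho lambda : R) (J : R -> {RV P >-> R}).
Hypothesis rho_lt1 : `|rho| < 1.

Let sg := Num.sqrt (1 / 2 : R).

(* The first two clauses give the jumps of [J]; the last one is the only
   consequence of the auto-regressive structure that matters: conditionally on
   the whole counter, [J t] keeps its stationary law. *)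
Definition jump_counter (nu : R -> Omega -> nat) : Prop :=
  [/\ poisson_process P lambda nu,
      exists A : nat -> Omega -> R, forall t w, 0 <= t -> J t w = A (nu t w) w &
      forall t H B, 0 <= t -> sigma_process `[0, +oo[ nu H -> measurable B ->
        P (H `&` J t @^-1` B) = (P H * normal_prob 0 sg B)%E].

Lemma PAR_jump_counter : PAR_process P rho lambda J -> exists nu, jump_counter nu.
Proof.
move=> [eps [nu [eps_iid nu_poisson nu_eps JE]]]; exists nu; split => //.
  by exists (ar_chain rho eps).
move=> t H B t0 sH mB.
have sg0 : 0 < sg by rewrite sqrtr_gt0 divr_gt0.
have mnu s : 0 <= s -> measurable_fun setT (nu s).
  exact: poisson_measurable nu_poisson.
rewrite -(PAR_law rho_lt1 sg0 eps_iid mnu nu_eps t0 sH mB); congr (P (_ `&` _)).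
by apply/seteqP; split => w /=; rewrite JE.
Qed.

End jump_process.

(** * Moments of Gaussian variables *)

Section law_integral.
Context d (Omega : measurableType d) (R : realType) (P : probability Omega R).

Lemma ge0_eq_law_integral d' (S : measurableType d') (Y1 Y2 : {mfun Omega >-> S})
    (f : S -> \bar R) :
  (forall A, measurable A -> P (Y1 @^-1` A) = P (Y2 @^-1` A)) ->
  measurable_fun setT f -> (forall x, 0 <= f x)%E ->
  (\int[P]_w f (Y1 w) = \int[P]_w f (Y2 w))%E.
Proof.
move=> Y12 mf f0.
rewrite -(@ge0_integral_distribution _ _ _ _ _ P Y1 f)//.
rewrite -(@ge0_integral_distribution _ _ _ _ _ P Y2 f)//.
by apply: eq_measure_integral => A mA _; exact: Y12.
Qed.

Lemma sqr_integrable (Y : {RV P >-> R}) :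
  (\int[P]_w (Y w ^+ 2)%:E < +oo)%E -> P.-integrable setT (EFin \o Y).
Proof.
move=> Y2; apply: (@le_integrable _ _ _ P setT measurableT _ (fun w => (1 + Y w ^+ 2)%:E)).
- exact/measurable_EFinP.
- move=> w _ /=; rewrite lee_fin [leRHS]ger0_norm ?addr_ge0 ?sqr_ge0//.
  have [Y1|/ltW Y1] := leP `|Y w| 1; first by rewrite (le_trans Y1)// lerDl sqr_ge0.
  by rewrite ler_wpDl// -real_normK ?num_real// ler_eXnr.
- apply/integrableP; split.
    by apply/measurable_EFinP; apply: measurable_funD => //; exact: measurable_funX.
  under eq_integral do rewrite gee0_abs ?lee_fin ?addr_ge0 ?sqr_ge0// EFinD.
  rewrite ge0_integralD//; last 2 first.
  - by move=> w _; rewrite lee_fin sqr_ge0.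
  - by apply/measurable_EFinP; exact: measurable_funX.
  rewrite integral_cst// mul1e lte_add_pinfty//.
  by rewrite ltey_eq fin_num_measure.
Qed.

Lemma gauss_abs (m s : R) : gauss m `|s| = gauss m s.
Proof. by rewrite /gauss normr_eq0 normal_prob_abs. Qed.

Lemma gaussN (m s : R) : gauss m (- s) = gauss m s.
Proof. by rewrite -gauss_abs normrN gauss_abs. Qed.

(** The second moment of the standard normal law is left unevaluated: the scales are only compared
    with each other. *)
Lemma gauss_second_moment (Y : {RV P >-> R}) (s : R) :
  has_law P Y (gauss 0 s) ->
  (\int[P]_w (Y w ^+ 2)%:E =
   (s ^+ 2)%:E * \int[normal_prob 0 1]_x (x ^+ 2)%:E)%E.
Proof.
move=> Ylaw.
have msq : measurable_fun setT (fun x : R => (x ^+ 2)%:E).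
  by apply/measurable_EFinP; exact: measurable_funX.
have sq0 (x : R) : (0 <= (x ^+ 2)%:E)%E by rewrite lee_fin sqr_ge0.
rewrite -(@ge0_integral_distribution _ _ _ _ _ P Y (fun x => (x ^+ 2)%:E))//.
have ms : measurable_fun [set: measurableTypeR R]
    ((fun x => s * x) : measurableTypeR R -> R) by exact: measurable_funM.
have [nu [nuE nuI]] := pushforward_measureP (normal_prob 0 1) ms.
transitivity (\int[nu]_x (x ^+ 2)%:E)%E.
  apply: eq_measure_integral => A mA _; rewrite nuE.
  rewrite [LHS]Ylaw//; have := gauss_affine 0 1 s 0 mA.
  rewrite mulr0 add0r mulr1 => <-; rewrite /gauss oner_eq0.
  by congr (normal_prob _ _ _); apply/seteqP; split => x /=; rewrite addr0.
rewrite nuI//; under eq_integral do rewrite exprMn EFinM.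
by rewrite ge0_integralZl// lee_fin sqr_ge0.
Qed.

(** By symmetry [Y - m] and [m - Y] have the same law, hence the same expectation; with E Y = 0 this
    reads - m = m. The second moment only serves to make [Y] integrable. *)
Lemma gauss_centered (Y : {RV P >-> R}) (m s : R) :
  has_law P Y (gauss m s) -> (\int[P]_w (Y w ^+ 2)%:E < +oo)%E ->
  ('E_P[Y] = 0)%E -> m = 0.
Proof.
move=> Ylaw Y2 EY.
have iY := sqr_integrable Y2.
have mU : measurable_fun setT (fun w => Y w - m) by exact: measurable_funB.
have mV : measurable_fun setT (fun w => m - Y w) by exact: measurable_funB.
pose U : {RV P >-> R} := mfun_Sub (mem_set mU).
pose V : {RV P >-> R} := mfun_Sub (mem_set mV).
have UV A : measurable A -> P (U @^-1` A) = P (V @^-1` A).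
  move=> mA.
  have -> : U @^-1` A = Y @^-1` [set x | A (1 * x + - m)].
    by apply/seteqP; split => w /=; rewrite mul1r.
  have -> : V @^-1` A = Y @^-1` [set x | A (-1 * x + m)].
    by apply/seteqP; split => w /=; rewrite mulN1r addrC.
  have mset c y : measurable [set x : R | A (c * x + y)].
    rewrite -[X in measurable X]setTI.
    have ma : measurable_fun setT (fun x : R => c * x + y).
      by apply: measurable_funD => //; exact: measurable_funM.
    exact: ma.
  rewrite [LHS]Ylaw; last exact: mset.
  rewrite [RHS]Ylaw; last exact: mset.
  have E1 := gauss_affine m s 1 (- m) mA; have E2 := gauss_affine m s (-1) m mA.
  by rewrite E1 E2 !mul1r !mulN1r subrr addNr gaussN.
have im : P.-integrable setT (cst m%:E) by exact: finite_measure_integrable_cst.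
have iU : P.-integrable setT (EFin \o U).
  by have := integrableB measurableT iY im; apply: eq_integrable.
have iV : P.-integrable setT (EFin \o V).
  by have := integrableB measurableT im iY; apply: eq_integrable.
have : (\int[P]_w (U w)%:E = \int[P]_w (V w)%:E)%E.
  rewrite -(@integral_distribution _ _ _ _ _ P U EFin)//.
  rewrite -(@integral_distribution _ _ _ _ _ P V EFin)//.
  by apply: eq_measure_integral => A mA _; exact: UV.
have EY0 : (\int[P]_w (Y w)%:E = 0)%E by rewrite -EY unlock.
have Em : (\int[P]_w cst m%:E w = m%:E)%E.
  by rewrite integral_cst//= [P _]probability_setT mule1.
have -> : (\int[P]_w (U w)%:E = - m%:E)%E.
  transitivity (\int[P]_w ((EFin \o Y) \- cst m%:E) w)%E => //.
  by rewrite integralB// EY0 sub0e Em.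
have -> : (\int[P]_w (V w)%:E = m%:E)%E.
  transitivity (\int[P]_w (cst m%:E \- (EFin \o Y)) w)%E => //.
  by rewrite integralB// EY0 sube0 Em.
by move=> [] /eqP; rewrite eq_sym -subr_eq0 opprK -mulr2n mulrn_eq0/= => /eqP.
Qed.

End law_integral.

(** * Marginals and increments of Z *)

Section gaussian_increments.
Context d (Omega : measurableType d) (R : realType) (P : probability Omega R)
  (T : R) (Z : R -> {RV P >-> R}) (Gamma : R -> R) (tau : R).
Hypotheses (T_gt0 : 0 < T)
  (Z_gaussian : gaussian_process P `[0, T] Z)
  (Z_centered : centered_process P `[0, T] Z)
  (Z_stationary : stationary_process P `[0, T] Z)
  (Z_cov : forall t, t \in `[0, T] ->
     ('E_P[fun w => (Z 0 w * Z t w)%R] = (Gamma t)%:E)%E)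
  (Gamma0 : Gamma 0 = 1 / 2)
  (tauT : tau \in `[0, T]) (Gamma_tau : Gamma tau != Gamma 0).

Let T0 : 0 \in `[0, T].
Proof. by rewrite in_itv/= lexx ltW. Qed.

Lemma stationary_pair t h B : 0 <= t -> 0 <= h -> t + h <= T -> measurable B ->
  P [set w | B (Z t w, Z (t + h) w)] = P [set w | B (Z 0 w, Z h w)].
Proof.
move=> t0 h0 thT mB.
pose B2 : set (2.-tuple R) := [set x | B (tnth x ord0, tnth x ord_max)].
have mB2 : measurable B2.
  rewrite -[X in measurable X]setTI.
  have mp : measurable_fun [set: 2.-tuple R]
      (fun x => (tnth x ord0, tnth x ord_max)).
    by apply: measurable_fun_pair; exact: measurable_tnth.
  exact: mp.
pose tt (i : 'I_2) : R := if i == ord0 then 0 else h.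
have ttT i : 0 <= tt i <= h by rewrite /tt; case: ifP; rewrite ?lexx ?h0.
have ttT1 i : `[0, T]%classic (tt i).
  rewrite /= in_itv/=; have /andP[-> /= tth] := ttT i.
  by rewrite (le_trans tth)// (le_trans _ thT)// lerDr.
have ttT2 i : `[0, T]%classic (tt i + t).
  rewrite /= in_itv/=; have /andP[tt0 tth] := ttT i.
  by rewrite addr_ge0//= (le_trans _ thT)// addrC lerD2l.
have := @Z_stationary 2 tt t ttT1 ttT2 B2 mB2.
have -> : [set w | B2 [tuple Z (tt i + t) w | i < 2]] =
    [set w | B (Z t w, Z (t + h) w)].
  by apply/seteqP; split => w; rewrite /B2/= !tnth_mktuple /tt/= add0r addrC.
have -> // : [set w | B2 [tuple Z (tt i) w | i < 2]] =
    [set w | B (Z 0 w, Z h w)].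
by apply/seteqP; split => w; rewrite /B2/= !tnth_mktuple /tt/=.
Qed.

Lemma stationary_marginal t B : t \in `[0, T] -> measurable B ->
  P (Z t @^-1` B) = P (Z 0 @^-1` B).
Proof.
rewrite in_itv/= => /andP[t0 tT] mB.
have mB2 : measurable [set p : R * R | B p.1].
  by rewrite -[X in measurable X]setTI; exact: measurable_fst.
have := @stationary_pair t 0 [set p | B p.1] t0 (lexx 0).
by rewrite addr0; apply.
Qed.

Let msq (Y : {RV P >-> R}) : measurable_fun setT (fun w => (Y w ^+ 2)%:E).
Proof. by apply/measurable_EFinP; exact: measurable_funX. Qed.

Let m2 : measurable_fun setT (fun x : R => (x ^+ 2)%:E).
Proof. by apply/measurable_EFinP; exact: measurable_funX. Qed.

Let sq_ge0 (x : R) : (0 <= (x ^+ 2)%:E)%E.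
Proof. by rewrite lee_fin sqr_ge0. Qed.

Lemma second_moment t : t \in `[0, T] -> (\int[P]_w (Z t w ^+ 2)%:E = (1 / 2)%:E)%E.
Proof.
move=> tT; rewrite (@ge0_eq_law_integral _ _ _ P _ _ (Z t) (Z 0) (fun x => (x ^+ 2)%:E))//.
  by rewrite -Gamma0 -Z_cov// unlock; apply: eq_integral => w _; rewrite expr2.
by move=> A mA; exact: stationary_marginal.
Qed.

Lemma Z_marginal_law : exists s, forall t, t \in `[0, T] ->
  has_law P (Z t) (gauss 0 s).
Proof.
have [m [s Zlaw]] := @Z_gaussian 1 (fun=> 0) (fun=> 1) (fun=> T0).
have Z0law : has_law P (Z 0) (gauss m s).
  move=> B mB; rewrite -[RHS]Zlaw//; congr (P _).
  by apply/seteqP; split => w /=; rewrite big_ord1 mul1r.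
have m0 : m = 0.
  apply: gauss_centered Z0law _ _; last exact: Z_centered.
  by rewrite second_moment// ltry.
exists s => t tT B mB; rewrite stationary_marginal//.
by rewrite m0 in Z0law; exact: Z0law.
Qed.

(** Written with the difference, so that the set is the preimage of a measurable set. *)
Let ne (p : R * R) : Prop := p.1 - p.2 <> 0.

Let measurable_ne : measurable ne.
Proof.
have mB : measurable_fun setT (fun p : R * R => p.1 - p.2) by exact: measurable_funB.
have := mB measurableT (~` [set 0]) (measurableC (measurable_set1 0)).
by rewrite setTI.
Qed.

Let neP x y : ne (x, y) <-> x <> y.
Proof.
rewrite /ne; split; apply: contra_not => /=; first by move=> ->; rewrite subrr.
by move/eqP; rewrite subr_eq0 => /eqP.
Qed.

Let measurable_neZ s t : measurable [set w | ne (Z s w, Z t w)].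
Proof.
have mp : measurable_fun setT (fun w => (Z s w, Z t w)) by exact: measurable_fun_pair.
by have := mp measurableT ne measurable_ne; rewrite setTI.
Qed.

Let neZ0 s t : P [set w | ne (Z s w, Z t w)] = 0%E ->
  (\int[P]_w (Z s w * Z t w)%:E = \int[P]_w (Z s w ^+ 2)%:E)%E.
Proof.
move=> P0; apply: ae_eq_integral => //.
- by apply/measurable_EFinP; exact: measurable_funM.
- exists [set w | ne (Z s w, Z t w)]; split => // w h; apply: contra_not h => /=.
  by move=> /eqP; rewrite subr_eq0 => /eqP /= -> _; rewrite expr2.
Qed.

(* If an increment vanished almost surely, stationarity would chain the
   equalities Z 0 = Z h = Z (2 h) = ... = Z tau. *)
Lemma increments_nondegenerate N : (0 < N)%N ->
  (0 < \int[P]_w ((Z 0 w - Z (tau / N%:R) w) ^+ 2)%:E)%E.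
Proof.
move=> N0; set h := tau / N%:R; have := tauT; rewrite in_itv/= => /andP[tau0 tauT'].
have h0 : 0 <= h by rewrite divr_ge0.
have Nh : N%:R * h = tau by rewrite mulrC divfK// pnatr_eq0 -lt0n.
have mD : measurable_fun setT (fun w => Z 0 w - Z h w) by exact: measurable_funB.
pose Dm : {RV P >-> R} := mfun_Sub (mem_set mD).
rewrite lt0e integral_ge0 ?andbT; last by move=> w _; exact: sq_ge0.
apply/negP => /eqP E0.
have ae0 : ae_eq P setT (fun w => ((Z 0 w - Z h w) ^+ 2)%:E) (cst 0%E).
  apply/ae_eq_integral_abs => //; first exact: (msq Dm).
  by under eq_integral do rewrite gee0_abs//.
have P0 : P [set w | ne (Z 0 w, Z h w)] = 0%E.
  apply: measure_negligible; first exact: measurable_neZ.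
  apply: negligibleS ae0 => w /= /neP new /(_ Logic.I) [] /eqP.
  by rewrite sqrf_eq0 subr_eq0 => /eqP.
have Pk k : (k <= N)%N -> P [set w | ne (Z 0 w, Z (k%:R * h) w)] = 0%E.
  elim: k => [_|k IHk kN].
    rewrite mul0r (_ : [set w | _] = set0) ?measure0//.
    by apply/seteqP; split => // w /neP.
  have kh : k%:R * h + h = k.+1%:R * h by rewrite -natr1 mulrDl mul1r.
  have kh0 : 0 <= k%:R * h by rewrite mulr_ge0.
  have khT : k%:R * h + h <= T.
    by rewrite kh (le_trans _ tauT')// -Nh ler_wpM2r// ler_nat.
  have := stationary_pair kh0 h0 khT measurable_ne; rewrite P0 kh => Pk1.
  apply/eqP; rewrite eq_le measure_ge0 andbT.
  apply: (@le_trans _ _ (P ([set w | ne (Z 0 w, Z (k%:R * h) w)] `|`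
      [set w | ne (Z (k%:R * h) w, Z (k.+1%:R * h) w)]))).
    apply: le_measure; rewrite ?inE; [exact: measurable_neZ| |].
      by apply: measurableU; exact: measurable_neZ.
    move=> w /neP n1; have [e|/eqP e] := eqVneq (Z 0 w) (Z (k%:R * h) w).
      by right; apply/neP; rewrite -e.
    by left; apply/neP.
  apply: (le_trans (measureU2 _ _ _)); try exact: measurable_neZ.
  by rewrite [X in (X + _)%E]IHk 1?ltnW// add0e [leLHS]Pk1.
(* At the end of the chain Z 0 = Z tau almost surely, so E (Z 0 * Z tau) = E (Z 0)^2, against
   [Gamma_tau]. *)
have := Pk N (leqnn N); rewrite Nh => /neZ0.
rewrite second_moment// -Gamma0 => E.
have := Z_cov tauT; rewrite unlock E => -[] /esym/eqP.
by rewrite (negbTE Gamma_tau).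
Qed.

(** By the parallelogram identity the squares of Z 0 + Z h and Z 0 - Z h have expectations with sum
    2. The second is positive, so the first is less than 2, which is the second moment of 2 * Z
    0. *)
Lemma Z_pair_sum_law s N : (0 < N)%N -> has_law P (Z 0) (gauss 0 s) ->
  exists2 s1, s1 ^+ 2 < 4 * s ^+ 2 &
  forall t, 0 <= t -> t + tau / N%:R <= T ->
  has_law P (fun w => Z t w + Z (t + tau / N%:R) w) (gauss 0 s1).
Proof.
move=> N0 Z0law; have D0 := increments_nondegenerate N0.
set h := tau / N%:R in D0 *.
have := tauT; rewrite in_itv/= => /andP[tau0 tauT'].
have h0 : 0 <= h by rewrite divr_ge0.
have hT : h <= T.
  by rewrite (le_trans _ tauT')// ler_pdivrMr ?ltr0n// ler_peMr// ler1n.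
have hI : h \in `[0, T] by rewrite in_itv/= h0.
have mS t : measurable_fun setT (fun w => Z t w + Z (t + h) w) by exact: measurable_funD.
have mD : measurable_fun setT (fun w => Z 0 w - Z h w) by exact: measurable_funB.
pose S t : {RV P >-> R} := mfun_Sub (mem_set (mS t)).
pose Dm : {RV P >-> R} := mfun_Sub (mem_set mD).
have SE w : S 0 w = Z 0 w + Z h w by rewrite /= add0r.
have parallelogram : (\int[P]_w (S 0 w ^+ 2)%:E + \int[P]_w (Dm w ^+ 2)%:E = 2%:E)%E.
  rewrite -ge0_integralD//.
  transitivity (\int[P]_w (2%:E * (Z 0 w ^+ 2)%:E + 2%:E * (Z h w ^+ 2)%:E))%E.
    apply: eq_integral => w _; rewrite -!EFinM -!EFinD SE; congr EFin => /=.
    by ring.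
  rewrite ge0_integralD//; last 4 first.
  - by move=> w _; rewrite mule_ge0.
  - exact/measurable_funeM.
  - by move=> w _; rewrite mule_ge0.
  - exact/measurable_funeM.
  rewrite !ge0_integralZl// !second_moment// -!EFinM -EFinD.
  by congr EFin; field.
have S2lt : (\int[P]_w (S 0 w ^+ 2)%:E < 2%:E)%E.
  have D0' : (0 < \int[P]_w (Dm w ^+ 2)%:E)%E by [].
  have Dge : (0 <= \int[P]_w (S 0 w ^+ 2)%:E)%E by apply: integral_ge0 => w _; exact: sq_ge0.
  move: parallelogram D0' Dge.
  case: (integral _ _ _) => [x||]; case: (integral _ _ _) => [y||] //=.
  by rewrite -EFinD => -[<-]; rewrite !lte_fin => y0 _; rewrite ltrDl.
have Sfin : (\int[P]_w (S 0 w ^+ 2)%:E < +oo)%E by rewrite (lt_trans S2lt)// ltry.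
pose tt (i : 'I_2) : R := if i == ord0 then 0 else h.
have ttT i : `[0, T]%classic (tt i) by rewrite /tt; case: ifP.
have [m [s1 Slaw]] := @Z_gaussian 2 tt (fun=> 1) ttT.
have S0law : has_law P (S 0) (gauss m s1).
  move=> B mB; rewrite -[RHS]Slaw//; congr (P _).
  by apply/seteqP; split => w /=; rewrite big_ord_recl big_ord1 /tt/= !mul1r add0r.
have ES : ('E_P[S 0%R] = 0)%E.
  have i0 : P.-integrable setT (EFin \o Z 0).
    by apply: sqr_integrable; rewrite second_moment// ltry.
  have ih : P.-integrable setT (EFin \o Z h).
    by apply: sqr_integrable; rewrite second_moment// ltry.
  rewrite unlock; transitivity (\int[P]_w ((EFin \o Z 0) \+ (EFin \o Z h)) w)%E.
    by apply: eq_integral => w _; rewrite SE.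
  rewrite integralD//; have := Z_centered T0; have := Z_centered hI.
  by rewrite unlock => -> ->; rewrite adde0.
have m0 := gauss_centered S0law Sfin ES; rewrite m0 in S0law.
exists s1; last first.
  move=> t t0 thT B mB; have mB2 : measurable [set p : R * R | B (p.1 + p.2)].
    have mp : measurable_fun setT (fun p : R * R => p.1 + p.2) by exact: measurable_funD.
    by rewrite -[X in measurable X]setTI; exact: mp.
  have := stationary_pair t0 h0 thT mB2 => /= E.
  rewrite -[RHS]S0law// -[LHS]/(P [set w | B (Z t w + Z (t + h) w)]) E; congr (P _).
  by apply/seteqP; split => w /=; rewrite add0r.
have := second_moment T0; rewrite (gauss_second_moment Z0law).
move: S2lt; rewrite (gauss_second_moment S0law).
(* Let k be the second moment of the standard normal law. Since [s ^+ 2] times k equals 1/2, k is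
   positive and finite, and it cancels from the comparison of [s1] with [s]. *)
have k0 : (0 <= \int[normal_prob (0 : R) 1]_x (x ^+ 2)%:E)%E.
  by apply: integral_ge0 => x _; exact: sq_ge0.
move: k0; case: (integral _ _ _) => [k||] //.
  rewrite lee_fin -!EFinM lte_fin => k0 s1k [sk].
  have k_gt0 : 0 < k.
    rewrite lt_neqAle k0 andbT; apply/eqP => k0'; move: sk.
    by rewrite -k0' mulr0 => /esym/eqP; rewrite gt_eqF// divr_gt0.
  rewrite -(ltr_pM2r k_gt0) -(mulrA 4) sk (lt_le_trans s1k)//.
  by lra.
move=> _; have [->|s0] := eqVneq s 0.
  by rewrite expr0n/= mul0e => _ -[/esym/eqP]; rewrite gt_eqF// divr_gt0.
by move=> _; rewrite gt0_muley// lte_fin exprn_even_gt0.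
Qed.

End gaussian_increments.

Lemma within_itv_continuousP (R : realType) (a b : R) (z : R -> R) (s e : R) :
  {within `[a, b], continuous z} -> s \in `[a, b] -> 0 < e ->
  exists2 r : R, 0 < r & forall t, t \in `[a, b] -> `|t - s| < r -> `|z t - z s| < e.
Proof.
move=> /subspace_continuousP cz sab e0.
have /cvgrPdist_lt/(_ e e0) [r /= r0 hr] := cz s sab.
exists r => // t tab ts; rewrite distrC; apply: (hr t) => //.
by rewrite /ball/= distrC.
Qed.

Lemma at_left_itvP (R : realType) (s : R) (Q : R -> Prop) :
  (\forall t \near s^'-, Q t) -> exists2 r : R, 0 < r & forall t, s - r < t -> t < s -> Q t.
Proof.
move=> [r /= r0 hr]; exists r => // t st ts; apply: (hr t) => //.
by rewrite /ball/= ger0_norm ?subr_ge0 1?ltW// ltrBlDr -ltrBlDl.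
Qed.

Lemma at_right_itvP (R : realType) (s : R) (Q : R -> Prop) :
  (\forall t \near s^'+, Q t) -> exists2 r : R, 0 < r & forall t, s < t -> t < s + r -> Q t.
Proof.
move=> [r /= r0 hr]; exists r => // t st ts; apply: (hr t) => //.
by rewrite /ball/= distrC ger0_norm ?subr_ge0 1?ltW// ltrBlDr addrC.
Qed.

Lemma cvg_small (R : realType) (T e : R) : 0 < e ->
  \forall m \near \oo, T / m.+1%:R < e.
Proof.
move=> e0; have /(cvgM (cvg_cst T)) := @cvg_harmonic R; rewrite mulr0.
by move/cvgr_lt/(_ _ e0).
Qed.

(** * Pathwise analysis of the crossings *)

Section discontinuous_upcrossings_bound.
Context (R : realType) (T u : R) (z j : R -> R) (B : nat -> R) (nu : R -> nat).
Hypotheses (T_gt0 : 0 < T) (cz : {within `[0, T], continuous z})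
  (jE : forall t, 0 <= t -> j t = B (nu t))
  (nu_right : forall t, 0 <= t -> \forall t' \near t^'+, nu t' = nu t)
  (nu_left : forall t, 0 < t -> exists k, \forall t' \near t^'-, nu t' = k).

Let x t := z t + j t.
Let D := discontinuous_upcrossings T u x.

Let grid m (k : nat) : R := k%:R * (T / m.+1%:R).

Let jump m (k : nat) : bool :=
  (j (grid m k) != j (grid m k.+1)) && (u < x (grid m k.+1)).

Let grid_itv m k : (k <= m.+1)%N -> grid m k \in `[0, T].
Proof.
move=> km; rewrite /grid in_itv/= mulr_ge0 ?divr_ge0 ?(ltW T_gt0)//= mulrCA ger_pMr//.
by rewrite ler_pdivrMr ?ltr0n// mul1r ler_nat.
Qed.

(** On either side of [s], [j] is locally constant. Once the mesh is smaller than all the radii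
    involved, the cell containing [s] sees the left value of [j] at its left end, and at its right
    end the value [j s] together with a value of [z] close to [z s]. *)
Let near_jump s : D s -> \forall m \near \oo, forall k, (k <= m)%N ->
  grid m k < s -> s <= grid m k.+1 -> jump m k.
Proof.
move=> [+ [l [xl /andP[lu ux]]]]; rewrite /= in_itv/= => /andP[s0 sT].
have sI : s \in `[0, T] by rewrite in_itv/= ltW.
have [k0 nuk0] := nu_left s0.
have [r1 r1_gt0 hr1] := at_left_itvP nuk0.
have [r2 r2_gt0 hr2] := at_right_itvP (nu_right (ltW s0)).
have xsu : 0 < x s - u by rewrite subr_gt0.
have [r3 r3_gt0 hr3] := within_itv_continuousP cz sI xsu.
have jl t : 0 <= t -> s - r1 < t -> t < s -> j t = B k0.
  by move=> t0 st ts; rewrite jE// (hr1 t).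
have jr t : s <= t -> t < s + r2 -> j t = j s.
  rewrite le_eqVlt => /predU1P[->//|st ts].
  by rewrite !jE ?(ltW s0)// ?(le_trans (ltW s0)) ?(ltW st)// (hr2 t).
have xr t : t \in `[0, T] -> `|t - s| < r3 -> u < z t + j s.
  move=> tT /(hr3 t tT); rewrite ltr_norml => /andP[+ _].
  by rewrite /x; lra.
(* Otherwise [x] would exceed [u] just to the left of [s], against its left limit [l < u]. *)
have js : B k0 != j s.
  apply/eqP => k0s.
  have xu : \forall t \near s^'-, x t < u by exact: cvgr_lt xl _ lu.
  have [t [[xtu t0 ts1] [ts2 ts]]] : exists t, [/\ x t < u, 0 <= t & s - r1 < t] /\
      (s - r3 < t /\ t < s).
    apply: (@filter_ex _ s^'-); near=> t; split; split.
    - by near: t.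
    - by near: t; exact: nbhs_left_ge.
    - by near: t; apply: nbhs_left_gt; rewrite ltrBlDr ltrDl.
    - by near: t; apply: nbhs_left_gt; rewrite ltrBlDr ltrDl.
    - by near: t; exact: nbhs_left_lt.
  have tT : t \in `[0, T] by rewrite in_itv/= t0 (le_trans (ltW ts)).
  have : u < z t + j s.
    by apply: xr => //; rewrite ltr0_norm ?subr_lt0// opprB ltrBlDr -ltrBlDl.
  by rewrite -k0s -(jl t)// ltNge (ltW xtu).
near=> m => k km ks sk.
have h0 : 0 < T / m.+1%:R by rewrite divr_gt0.
have gE : grid m k.+1 = grid m k + T / m.+1%:R by rewrite /grid -natr1 mulrDl mul1r.
have hr : T / m.+1%:R < Num.min r1 (Num.min r2 r3).
  by near: m; apply: cvg_small; rewrite !lt_min r1_gt0 r2_gt0.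
move: hr; rewrite !lt_min => /and3P[h1 h2 h3].
have gk0 : 0 <= grid m k by have := grid_itv (leqW km); rewrite in_itv => /andP[].
have gT := grid_itv (km : (k.+1 <= m.+1)%N).
have gs : grid m k.+1 - s < T / m.+1%:R by rewrite gE ltrBlDr addrC ltrD2l.
have gl : s - r1 < grid m k by rewrite ltrBlDr (le_lt_trans sk)// gE ltrD2l.
have gr : grid m k.+1 < s + r2 by rewrite -ltrBlDl (lt_trans gs).
apply/andP; split; first by rewrite (jl _ gk0 gl ks) (jr _ sk gr).
rewrite /x (jr _ sk gr); apply: xr => //.
by rewrite ger0_norm ?subr_ge0// (lt_trans gs).
Unshelve. all: by end_near. Qed.

Let index_bound (s : R) m : s \in `]0, T] ->
  exists k : 'I_m.+1, (grid m k < s) && (s <= grid m k.+1).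
Proof.
rewrite in_itv/= => /andP[s0 sT].
have ex : exists k, s <= grid m k.+1.
  by exists m; rewrite /grid mulrC divfK// pnatr_eq0.
have hk := ex_minnP ex; case: hk => k sk kmin.
have km : (k < m.+1)%N.
  by rewrite ltnS; apply: kmin; rewrite /grid mulrC divfK// pnatr_eq0.
exists (Ordinal km); rewrite /= sk andbT.
case: k sk kmin km => [|k] sk kmin km; first by rewrite /grid mul0r.
by rewrite ltNge; apply/negP => /kmin; rewrite ltnn.
Qed.

(** For [s] in []0, T]] some cell always exists, so the default [ord0] is never taken there. *)
Let index (m : nat) (s : R) : 'I_m.+1 :=
  odflt ord0 [pick k : 'I_m.+1 | (grid m k < s) && (s <= grid m k.+1)].

Let indexP m s : s \in `]0, T] ->
  grid m (index m s) < s /\ s <= grid m (index m s).+1.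
Proof.
move=> /(index_bound m)[k0 k0P]; rewrite /index; case: pickP => [k /andP[]//|].
by move/(_ k0); rewrite k0P.
Qed.

(** On a fine grid every point of [F] lies in a flagged cell and distinct points lie in distinct
    cells. Finite lists are used because the set of crossings is not known to be finite. *)
Lemma card_discontinuous_upcrossings (F : seq R) : uniq F -> [set` F] `<=` D ->
  \forall m \near \oo, (size F <= \sum_(k < m.+1) jump m k)%N.
Proof.
move=> uF FD.
have near1 : \forall m \near \oo, forall s, [set` F] s -> jump m (index m s).
  apply: near_finite => [|s sF]; first exact: finite_seq.
  have Ds := FD s sF; apply: filterS (near_jump Ds) => m h.
  have [sk ks] := indexP m Ds.1; apply: h => //; rewrite -ltnS; exact: ltn_ord.
(* Two distinct points are separated as soon as the mesh is smaller than their distance. *)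
have near2 : \forall m \near \oo, forall p : R * R, [set` F] p.1 /\ [set` F] p.2 ->
    p.1 < p.2 -> index m p.1 != index m p.2.
  apply: near_finite => [|[s t] /= [sF tF]].
    apply: (@sub_finite_set _ _ ([set` F] `*` [set` F])) => //.
    by apply: finite_setX; exact: finite_seq.
  have [st|ts] := ltP s t; last by near=> m.
  near=> m => _; apply/eqP => idx.
  have [sk ks] := indexP m (FD s sF).1; have [tk kt] := indexP m (FD t tF).1.
  have gE k : grid m k.+1 = grid m k + T / m.+1%:R by rewrite /grid -natr1 mulrDl mul1r.
  have hr : T / m.+1%:R < t - s by near: m; apply: cvg_small; rewrite subr_gt0.
  move: hr; apply/negP; rewrite -leNgt lerBlDr (le_trans kt)// gE -idx.
  by rewrite addrC lerD2l ltW.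
near=> m.
have h1 : forall s, s \in F -> jump m (index m s) by near: m.
have h2 : forall p : R * R, [set` F] p.1 /\ [set` F] p.2 ->
    p.1 < p.2 -> index m p.1 != index m p.2 by near: m.
have inj : {in F &, injective (index m)}.
  move=> s t sF tF idx; have [st|ts|//] := ltgtP s t.
    by have := h2 (s, t) (conj sF tF) st; rewrite idx eqxx.
  by have := h2 (t, s) (conj tF sF) ts; rewrite idx eqxx.
have us : uniq (map (index m) F) by rewrite map_inj_in_uniq.
rewrite -(size_map (index m)) -(card_uniqP us).
rewrite -sum1_card big_mkcond/= leq_sum// => k _.
by case: ifP => // /mapP[s sF ->]; rewrite h1.
Unshelve. all: by end_near. Qed.

End discontinuous_upcrossings_bound.

(* No measurability is assumed: the integral of a nonnegative function is the
   supremum of the integrals of the simple functions below it. *)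
Lemma ge0_le_integral_any d (S : measurableType d) (R : realType)
    (mu : {measure set S -> \bar R}) (f g : S -> \bar R) :
  (forall x, 0 <= f x)%E -> (forall x, f x <= g x)%E ->
  (\int[mu]_x f x <= \int[mu]_x g x)%E.
Proof.
move=> f0 fg; rewrite !ge0_integralTE//; last first.
  by move=> x; exact: le_trans (f0 x) (fg x).
by apply: le_ereal_sup => _ [h /= hf <-]; exists h => // x; exact: le_trans (fg x).
Qed.

Lemma limn_einf_ge (R : realType) (v : nat -> \bar R) (c : \bar R) :
  (\forall m \near \oo, c <= v m)%E -> (c <= limn_einf v)%E.
Proof.
move=> [M _ hM]; rewrite limn_einf_lim.
apply: lime_ge; first exact: is_cvg_einfs.
exists M => // m /= Mm; apply: le_ereal_inf_tmp => _ [k /= mk <-].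
by apply: hM; exact: leq_trans mk.
Qed.

Lemma limn_einf_le (R : realType) (v : nat -> \bar R) (c : \bar R) :
  (forall m, v m <= c)%E -> (limn_einf v <= c)%E.
Proof.
move=> vc; rewrite limn_einf_lim; apply: lime_le; first exact: is_cvg_einfs.
apply: nearW => m; apply: le_trans (vc m).
by apply: ereal_inf_lbound; exists m => /=.
Qed.

(** If [D] is infinite, it has finite subsets of any size, which pushes the lower limit to +oo. *)
Lemma counting_le_limn_einf (R : realType) (I : choiceType) (D : set I)
    (v : nat -> nat) :
  (forall F : seq I, uniq F -> [set` F] `<=` D ->
    \forall m \near \oo, (size F <= v m)%N) ->
  (counting D <= limn_einf (fun m => (v m)%:R%:E) :> \bar R)%E.
Proof.
move=> Dv; rewrite /counting; case: ifPn => [/asboolP finD|/asboolP infD].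
  apply: limn_einf_ge; have := Dv (enum_fset (fset_set D)) (fset_uniq _).
  move=> /(_ _)/filterS; apply; last first.
    by rewrite -[X in X `<=` _]/([set` fset_set D]) fset_setK.
  move=> m; rewrite lee_fin ler_nat; exact.
rewrite leye_eq; apply/eqP/eqyP => r r0.
have [F FD nF] := infinite_set_fset (Num.truncn r).+1 infD.
apply: limn_einf_ge; apply: filterS (Dv (enum_fset F) (fset_uniq _) FD) => m Fm.
rewrite lee_fin (le_trans (ltW (truncnS_gt r)))// ler_nat (leq_trans _ Fm)//.
Qed.

(** Heine's theorem, from the covering form of compactness: each point [x] has a neighbourhood and a
    modulus that work together, by splitting [r] and [e] into halves. *)
Lemma segment_unif_continuous (R : realType) (a b e : R) (g : R -> R) :
  {within `[a, b], continuous g} -> 0 < e ->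
  exists2 r : R, 0 < r & forall x y, x \in `[a, b] -> y \in `[a, b] ->
    `|y - x| < r -> `|g y - g x| < e.
Proof.
move=> cg e0.
have cover := (compact_near_coveringP _).1 (@segment_compact R a b).
have := cover R 0^'+ (fun r x => x \in `[a, b] ->
    forall y, y \in `[a, b] -> `|y - x| < r -> `|g y - g x| < e) _.
move=> /(_ _)[x xab|].
  have e20 : 0 < e / 2 by rewrite divr_gt0.
  have [r r0 hr] := within_itv_continuousP cg xab e20.
  have r20 : 0 < r / 2 by rewrite divr_gt0.
  near=> x' r' => /= x'ab y yab yx'.
  have x'x : `|x' - x| < r / 2.
    by rewrite distrC; near: x'; apply: nbhsx_ballx.
  have r'r : r' < r / 2 by near: r'; exact: nbhs_right_lt.
  have yx : `|y - x| < r.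
    rewrite (splitr r) (le_lt_trans (ler_distD x' _ _))// ltrD// (lt_trans yx')//.
  have hx' := hr x' x'ab (lt_trans x'x _).
  rewrite (splitr e) (le_lt_trans (ler_distD (g x) _ _))// ltrD//; first exact: hr.
  by rewrite distrC hx'// ltr_pdivrMr// ltr_pMr// ltr1n.
move=> r /= r0 hr; have r20 : 0 < r / 2 by rewrite divr_gt0.
exists (r / 2) => // x y xab yab; apply: (hr (r / 2)) => //=.
by rewrite sub0r normrN gtr0_norm// ltr_pdivrMr// ltr_pMr// ltr1n.
Unshelve. all: by end_near. Qed.

(** * Crossings of continuously differentiable paths *)

Section C1_crossings.
Context (R : realType) (T : R) (z : R -> R).
Hypotheses (T_gt0 : 0 < T) (zC1 : C1_on 0 T z).

Let cz : {within `[0, T], continuous z}.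
Proof. by have [zder _] := zC1; exact: derivable_oo_LRcontinuous_within. Qed.

Let sub_within a b : 0 <= a -> b <= T -> {within `[a, b], continuous z}.
Proof.
move=> a0 bT; apply: continuous_subspaceW cz => x /=; rewrite !in_itv/=.
by move=> /andP[ax xb]; rewrite (le_trans a0)//= (le_trans xb).
Qed.

Let slope g a b : {in `]0, T[, forall t, z^`()%classic t = g t} ->
  0 <= a -> a < b -> b <= T ->
  exists2 c, a < c < b & z b - z a = g c * (b - a).
Proof.
move=> zg a0 ab bT; have [[zder _ _] _] := zC1.
have H x : x \in `]a, b[ -> is_derive x 1 z (g x).
  rewrite in_itv/= => /andP[ax xb].
  have xT : x \in `]0, T[ by rewrite in_itv/= (le_lt_trans a0 ax) (lt_le_trans xb).
  by rewrite -zg// derive1E; apply: derivableP; exact: zder.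
have [c cab ->] := MVT ab H (sub_within a0 bT).
by exists c => //; rewrite in_itv/= in cab.
Qed.

(* The slope is tested on rational points only, so that this is a countable
   intersection of events when [z] is a random path. *)
Definition good_piece (e p q : R) : Prop :=
  forall a b : rat, p <= ratr a -> ratr a < ratr b :> R -> ratr b <= q ->
    e * (ratr b - ratr a) <= z (ratr b) - z (ratr a).

(** The intermediate value theorem gives a crossing [s]. If the derivative there were below [e], it
    would stay below [e] on a short interval to the right of [s], and two rationals in that interval
    would violate [good_piece]. *)
Lemma good_piece_crossing e p q y : 0 < e -> 0 <= p -> q <= T -> p < q ->
  z p < y -> y < z q -> good_piece e p q ->
  exists s, [/\ p < s < q, z s = y, derivable z s 1 & 0 < z^`()%classic s].
Proof.
move=> e0 p0 qT pq zpy yzq good; have [[zder _ _] [g cg zg]] := zC1.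
have [s spq zs] : exists2 s, s \in `[p, q] & z s = y.
  apply: IVT; [exact: ltW|exact: sub_within|].
  have zpq := lt_trans zpy yzq.
  by rewrite (min_l (ltW zpq)) (max_r (ltW zpq)) !ltW.
have ps : p < s.
  move: spq; rewrite in_itv/= => /andP[]; rewrite le_eqVlt => /predU1P[ps|//].
  by move: zpy; rewrite ps zs ltxx.
have sq : s < q.
  move: spq; rewrite in_itv/= => /andP[_]; rewrite le_eqVlt => /predU1P[sq|//].
  by move: yzq; rewrite -sq zs ltxx.
have sT : s \in `]0, T[ by rewrite in_itv/= (le_lt_trans p0 ps) (lt_le_trans sq).
have sT' : s \in `[0, T] by move: sT; rewrite !in_itv/= => /andP[/ltW -> /ltW ->].
exists s; split => //; rewrite ?ps//; first exact: zder.
rewrite zg// (lt_le_trans e0)// leNgt; apply/negP => gse.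
have gse' : 0 < e - g s by rewrite subr_gt0.
have [r r0 hr] := within_itv_continuousP cg sT' gse'.
(* Rationals below [q'] lie both in the piece and within the radius on which [g] stays below [e]. *)
pose q' := Num.min q (s + r).
have sq' : s < q' by rewrite lt_min sq ltrDl.
have [a /andP[sa aq]] := rat_in_itvoo sq'.
have [b /andP[ab bq]] := rat_in_itvoo aq.
have aT : 0 <= ratr a :> R by rewrite (le_trans p0)// ltW// (lt_trans ps).
have bq1 : ratr b < q by rewrite (lt_le_trans bq)// ge_min lexx.
have bq2 : ratr b < s + r by rewrite (lt_le_trans bq)// ge_min lexx orbT.
have bT : ratr b <= T by rewrite (le_trans (ltW bq1)).
have [c /andP[ac cb] E] := slope zg aT ab bT.
have := good a b (ltW (lt_trans ps sa)) ab (ltW bq1).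
rewrite E ler_pM2r ?subr_gt0//; apply/negP; rewrite -ltNge.
have cT : c \in `[0, T].
  by rewrite in_itv/= (le_trans aT (ltW ac)) (le_trans (ltW cb)).
have := hr c cT _; rewrite gtr0_norm ?subr_gt0 ?(lt_trans sa)//.
rewrite ltrBlDl (lt_trans cb)// => /(_ isT); rewrite ltr_norml => /andP[_].
by rewrite ltrBlDr subrK.
Qed.

(** A mean slope above [e] is attained by the derivative at some point of the piece, and on a short
    piece the derivative varies by less than [e / 2]. The radius depends on the path [z], so a
    random path has no common grid on which this applies. *)
Lemma steep_pieces_good e : 0 < e -> exists2 r : R, 0 < r &
  forall p q, 0 <= p -> p < q -> q <= T -> q - p < r ->
    e * (q - p) < z q - z p -> good_piece (e / 2) p q.
Proof.
move=> e0; have [_ [g cg zg]] := zC1.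
have e20 : 0 < e / 2 by rewrite divr_gt0.
have [r r0 hr] := segment_unif_continuous cg e20.
exists r => // p q p0 pq qT qpr steep a b pa ab bq.
have a0 : 0 <= ratr a :> R by exact: le_trans pa.
have bT : ratr b <= T by exact: le_trans qT.
have [c /andP[pc cq] Ec] := slope zg p0 pq qT.
have [x /andP[ax xb] Ex] := slope zg a0 ab bT.
rewrite Ex ler_pM2r ?subr_gt0//.
have gc : e < g c by move: steep; rewrite Ec ltr_pM2r ?subr_gt0.
have cT : c \in `[0, T].
  by rewrite in_itv/= (le_trans p0 (ltW pc)) (le_trans (ltW cq)).
have xT : x \in `[0, T].
  by rewrite in_itv/= (le_trans a0 (ltW ax)) (le_trans (ltW xb)).
have px : p < x by exact: le_lt_trans ax.
have xq : x < q by exact: lt_le_trans bq.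
have xc : `|x - c| < r.
  rewrite (lt_trans _ qpr)// ltr_norml opprB.
  by rewrite ltrD ?ltrN2//= ltrD// ltrN2.
have := hr c x cT xT xc; rewrite ltr_norml => /andP[+ _].
by rewrite ltrNl opprB ltrBlDl -ltrBlDr => /ltW; apply: le_trans; lra.
Qed.

End C1_crossings.

(** * Gaussian tails *)

Lemma normal_tail_gt0 (R : realType) (b u : R) : b != 0 ->
  (0 < normal_prob 0 b `]u, +oo[)%E.
Proof.
(* The density at distance |u| + 1 from its centre, a lower bound for it on []u, u + 1[]. *)
move=> b0; pose c := normal_peak b * expR (- (`|u| + 1) ^+ 2 / (b ^+ 2 *+ 2)).
have c0 : 0 < c by rewrite mulr_gt0 ?normal_peak_gt0 ?expR_gt0.
have le_c x : x \in `]u, (u + 1)[ -> c <= normal_pdf 0 b x.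
  rewrite in_itv/= => /andP[ux xu]; rewrite normal_pdfE// /c ler_wpM2l ?normal_peak_ge0//.
  rewrite /normal_fun ler_expR ler_wpM2r ?invr_ge0 ?mulrn_wge0 ?sqr_ge0//.
  have xu' : `|x| <= `|u| + 1.
    have /(lerD (lexx `|u|)) : `|x - u| <= 1 by rewrite ger0_norm ?subr_ge0 ?lerBlDl; exact: ltW.
    by apply: le_trans; rewrite -{1}(subrK u x) addrC ler_normD.
  rewrite subr0 lerN2 -(real_normK (num_real x)).
  by rewrite ler_pXn2r// nnegrE// addr_ge0.
pose v := u + 1; have uv : u < v by rewrite ltrDl.
apply: (@lt_le_trans _ _ (\int[lebesgue_measure]_(x in `]u, v[) c%:E)%E).
  rewrite integral_cst//; have := lebesgue_measure_itv `]u, v[.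
  rewrite [X in (_ * X)%E]/= => ->; rewrite /= lte_fin uv.
  by rewrite -EFinD -EFinM lte_fin mulr_gt0// subr_gt0.
have mpdf D : measurable_fun D (fun x : R => (normal_pdf 0 b x)%:E).
  by apply/measurable_EFinP/measurable_funTS; exact: measurable_normal_pdf.
apply: (@le_trans _ _ (\int[lebesgue_measure]_(x in `]u, v[) (normal_pdf 0 b x)%:E)%E).
  apply: ge0_le_integral => //.
  - by move=> x _; rewrite lee_fin ltW.
  - exact: mpdf.
apply: ge0_subset_integral => //.
- exact: mpdf.
- by move=> x _; rewrite lee_fin normal_pdf_ge0.
- by move=> x /=; rewrite !in_itv/= => /andP[->].
Qed.

(** The ratio of the densities is [c * expR (- (k * x ^+ 2))] with k > 0. It decreases for x >= 0,
    so its smallness at [u] controls the whole tail. *)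
Lemma normal_tail_negligible (R : realType) (a b eps : R) : 0 < a -> a < b -> 0 < eps ->
  exists U, forall u, U <= u ->
  (normal_prob 0 a `]u, +oo[ <= eps%:E * normal_prob 0 b `]u, +oo[)%E.
Proof.
move=> a0 ab eps0; have b0 := lt_trans a0 ab.
have an0 : a != 0 by rewrite gt_eqF.
have bn0 : b != 0 by rewrite gt_eqF.
pose k := (a ^+ 2 *+ 2)^-1 - (b ^+ 2 *+ 2)^-1.
have k0 : 0 < k.
  rewrite subr_gt0 ltf_pV2 ?posrE ?mulrn_wgt0 ?exprn_gt0// ltr_pMn2r//.
  by rewrite ltr_pXn2r ?nnegrE ?ltW.
pose c := normal_peak a / normal_peak b.
have pa0 := normal_peak_gt0 an0; have pb0 := normal_peak_gt0 bn0.
have c0 : 0 < c by rewrite divr_gt0.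
(* Since exp y >= y, it suffices that c <= eps * k * u^2; for u >= 1 this follows from c <= eps * k
   * u. *)
exists (Num.max 1 (c / (k * eps))) => u; rewrite ge_max => /andP[u1 ku].
have u0 := le_trans ler01 u1.
have small : c * expR (- (k * u ^+ 2)) <= eps.
  rewrite expRN ler_pdivrMr ?expR_gt0//.
  apply: (@le_trans _ _ (eps * (k * u ^+ 2))); last first.
    by rewrite ler_pM2l// (le_trans _ (expR_ge1Dx _))// lerDr.
  apply: (@le_trans _ _ (eps * (k * u))).
    move: ku; rewrite ler_pdivrMr ?mulr_gt0// => /le_trans; apply.
    by rewrite mulrC -mulrA mulrCA.
  by rewrite ler_pM2l// ler_pM2l// expr2 ler_peMl.
have mpdf s D : measurable_fun D (fun x : R => (normal_pdf 0 s x)%:E).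
  by apply/measurable_EFinP/measurable_funTS; exact: measurable_normal_pdf.
have pdf0 s (x : R) : (0 <= (normal_pdf 0 s x)%:E)%E by rewrite lee_fin normal_pdf_ge0.
have eps0' := ltW eps0.
rewrite /normal_prob -ge0_integralZl ?lee_fin//; last exact: mpdf.
apply: ge0_le_integral => //.
  exact: mpdf.
  by apply: measurable_funeM; exact: mpdf.
move=> x /=; rewrite in_itv/= andbT => ux.
rewrite -EFinM lee_fin !normal_pdfE// /normal_fun !subr0.
have -> : - x ^+ 2 / (a ^+ 2 *+ 2) = - (k * x ^+ 2) + - x ^+ 2 / (b ^+ 2 *+ 2).
  by rewrite /k; ring.
rewrite expRD.
apply: (@le_trans _ _ ((c * expR (- (k * u ^+ 2))) *
    (normal_peak b * expR (- x ^+ 2 / (b ^+ 2 *+ 2))))).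
  have -> : normal_peak a = c * normal_peak b by rewrite divfK// gt_eqF.
  rewrite [leRHS]mulrACA; apply: ler_wpM2l; first exact: ltW (mulr_gt0 c0 pb0).
  apply: ler_wpM2r; first exact: expR_ge0.
  have ux' := ltW ux; have x0 := le_trans u0 ux'.
  by rewrite ler_expR lerN2 ler_pM2l// ler_pXn2r// nnegrE.
by rewrite ler_wpM2r// mulr_ge0 ?expR_ge0// ltW.
Qed.

Lemma counting_ge (R : realType) (T : choiceType) (A : set T) (N : nat)
  (b : pred 'I_N) (x : 'I_N -> T) : {in b &, injective x} ->
  (forall i, b i -> A (x i)) -> ((#|b|%:R : R)%:E <= counting A)%E.
Proof.
move=> inj_x Ax; rewrite /counting; have [/asboolP finA|/asboolP infA] := boolP `[< finite_set A >].
  rewrite lee_fin ler_nat cardE -(size_map x (enum b)).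
  apply: uniq_leq_size.
    rewrite map_inj_in_uniq ?enum_uniq// => i j; rewrite !mem_enum; exact: inj_x.
  move=> y /mapP[i]; rewrite mem_enum => bi ->; rewrite in_fset_set// inE; exact: Ax.
by rewrite leey.
Qed.

(** Positivity of [g u] excludes the inverse of 0, and where [g u] is infinite the quotient is 0; so
    the quotients are eventually finite and the limit can be taken in the reals. *)
Lemma little_o_pinfty_le (R : realType) (f g : R -> \bar R) : (forall u, 0 <= f u)%E ->
  (forall eps, 0 < eps ->
     \forall u \near +oo, (0 < g u)%E /\ (f u <= eps%:E * g u)%E) ->
  little_o_pinfty f g.
Proof.
move=> f0 fg.
have ratio eps : 0 < eps -> \forall u \near +oo, (0 <= f u / g u <= eps%:E)%E.
  move=> eps0; have := fg _ eps0; apply: filterS => u; have := f0 u.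
  case: (g u) => [r| |] fu0 [gu0 fgu]; last by [].
    move: gu0; rewrite lte_fin => r0; rewrite inver gt_eqF//.
    move: fgu fu0; case: (f u) => [x| |] //=; rewrite -?EFinM !lee_fin => xr x0.
    by rewrite divr_ge0 ?(ltW r0)//= ler_pdivrMr.
  by rewrite invey mule0 lexx lee_fin ltW.
rewrite /little_o_pinfty; apply/fine_cvgP; split.
  have := ratio 1 ltr01; apply: filterS => u /andP[ge0 le1].
  by rewrite ge0_fin_numE// (le_lt_trans le1)// ltry.
apply/cvgr0Pnorm_le => eps eps0; have := ratio _ eps0; apply: filterS => u /andP[ge0 le_eps].
have fin : (f u / g u)%E \is a fin_num by rewrite ge0_fin_numE// (le_lt_trans le_eps)// ltry.
by rewrite /= ger0_norm ?fine_ge0// -lee_fin fineK.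
Qed.

(** * Expected numbers of up-crossings *)

Section upcrossing_expectations.
Context d (Omega : measurableType d) (R : realType) (P : probability Omega R)
  (T lambda : R) (Z J : R -> {RV P >-> R}) (nu : R -> Omega -> nat) (s : R).
Hypotheses (T_gt0 : 0 < T) (lambda_gt0 : 0 < lambda)
  (Z_C1 : forall w, C1_on 0 T (fun t => Z t w))
  (ZJ_indep : independent_systems P (sigma_process `[0, T] Z)
                                    (sigma_process `[0, T] J))
  (Z_law : forall t, t \in `[0, T] -> has_law P (Z t) (gauss 0 s))
  (J_nu : jump_counter lambda J nu).

Let sgJ := Num.sqrt (1 / 2 : R).
Let sgX := Num.sqrt (s ^+ 2 + sgJ ^+ 2).
Let tail u := normal_prob 0 sgX `]u, +oo[.

Let Z_cont w : {within `[0, T], continuous (fun t => Z t w)}.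
Proof. by have [Zder _] := Z_C1 w; exact: derivable_oo_LRcontinuous_within. Qed.

Let sgJ0 : sgJ != 0.
Proof. by rewrite gt_eqF// sqrtr_gt0 divr_gt0. Qed.

Let poisson : poisson_process P lambda nu. Proof. by case: J_nu. Qed.

Let nu_mono w a b : 0 <= a -> a <= b -> (nu a w <= nu b w)%N.
Proof.
have [W [_ nuP]] := poisson.
exact: (@counting_fun_mono _ (fun n => \sum_(i < n.+1) W i w) (nu^~ w) (nuP^~ w)).
Qed.

Let nu_right w t : 0 <= t -> \forall t' \near t^'+, nu t' w = nu t w.
Proof.
have [W [_ nuP]] := poisson.
exact: (@counting_fun_right _ (fun n => \sum_(i < n.+1) W i w) (nu^~ w) (nuP^~ w)).
Qed.

Let nu_left w t : 0 < t -> exists k, \forall t' \near t^'-, nu t' w = k.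
Proof.
have [W [_ nuP]] := poisson.
exact: (@counting_fun_left _ (fun n => \sum_(i < n.+1) W i w) (nu^~ w) (nuP^~ w)).
Qed.

Let measurable_tail u : measurable (`]u, +oo[%classic : set R).
Proof. exact: measurable_itv. Qed.

Let sigma_J_eq a b : a \in `[0, T] -> b \in `[0, T] ->
  sigma_process `[0, T] J [set w | J a w = J b w].
Proof.
move=> aT bT.
have ma := @sigma_process_measurable_fun _ _ _ _ _ `[0, T]%classic J a aT.
have mb := @sigma_process_measurable_fun _ _ _ _ _ `[0, T]%classic J b bT.
have mab := measurable_funB ma mb.
have := mab measurableT [set 0] (measurable_set1 0).
rewrite setTI; congr (sigma_process _ _ _); apply/seteqP; split => w /=.
  by move/eqP; rewrite subr_eq0 => /eqP.
by move=> ->; rewrite subrr.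
Qed.

Let sigma_nu_eq a b : 0 <= a -> 0 <= b ->
  sigma_process `[0, +oo[ nu [set w | nu a w = nu b w].
Proof.
move=> a0 b0.
have -> : [set w | nu a w = nu b w] =
    \bigcup_n (nu a @^-1` [set n] `&` nu b @^-1` [set n]).
  apply/seteqP; split => w /=; first by move=> E; exists (nu a w).
  by move=> [n _ [-> ->]].
apply: sigma_process_bigcup => n; apply: sigma_process_setI.
  by apply: sigma_process_preimage => //=; rewrite in_itv/= a0.
by apply: sigma_process_preimage => //=; rewrite in_itv/= b0.
Qed.

Let sigma_J_measurable A : sigma_process `[0, T] J A -> measurable A.
Proof. by apply: sigma_process_measurable => t _; exact: measurable_funPT. Qed.

Let sigma_nu_measurable A : sigma_process `[0, +oo[ nu A -> measurable A.
Proof.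
apply: sigma_process_measurable => t /=; rewrite in_itv/= andbT.
exact: poisson_measurable poisson.
Qed.

Let Z_indep t b F : t \in `[0, T] -> b \in `[0, T] -> sigma_process `[0, T] J F ->
  forall A B, measurable A -> measurable B ->
  P (Z t @^-1` A `&` (F `&` J b @^-1` B)) =
  (P (Z t @^-1` A) * P (F `&` J b @^-1` B))%E.
Proof.
move=> tT bT sF A B mA mB; apply: ZJ_indep.
  exact: sigma_process_preimage.
by apply: sigma_process_setI => //; exact: sigma_process_preimage.
Qed.

(** Independence of Z is applied to the event that J changes, which belongs to J. Only then is this
    event enlarged to a change of [nu], given which [J b] keeps its Gaussian law. *)
Lemma jump_above_le a b u : a \in `[0, T] -> b \in `[0, T] ->
  (P ([set w | J a w <> J b w] `&` [set w | u < Z b w + J b w]%R) <=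
   P [set w | nu a w <> nu b w] * tail u)%E.
Proof.
move=> aT bT; have [_ [A JA] J_law] := J_nu.
have a0 : 0 <= a by move: aT; rewrite in_itv/= => /andP[].
have b0 : 0 <= b by move: bT; rewrite in_itv/= => /andP[].
have sF : sigma_process `[0, T] J [set w | J a w <> J b w].
  exact: sigma_process_setC (sigma_J_eq aT bT).
have sH : sigma_process `[0, +oo[ nu [set w | nu a w <> nu b w].
  exact: sigma_process_setC (sigma_nu_eq a0 b0).
have := @indep_gauss_sum_le _ _ _ P (Z b) (J b) _ 0 s sgJ
  (P [set w | nu a w <> nu b w]) (sigma_J_measurable sF) sgJ0 _ (Z_law bT)
  (Z_indep bT bT sF) `]u, +oo[%classic (measurable_tail u).
have -> : [set w | `]u, +oo[%classic (Z b w + J b w)] = [set w | u < Z b w + J b w].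
  by apply/seteqP; split => w /=; rewrite in_itv/= andbT.
apply; first exact: measure_ge0.
move=> B mB; rewrite -(J_law _ _ _ b0 sH mB); apply: le_measure; rewrite ?inE.
- apply: measurableI; first exact: sigma_J_measurable.
  exact: measurable_funPTI.
- apply: measurableI; first exact: sigma_nu_measurable.
  exact: measurable_funPTI.
- move=> w [/= Jab Bw]; split => //; apply: contra_not Jab.
  by rewrite !JA// => ->.
Qed.

Let grid m (k : nat) : R := k%:R * (T / m.+1%:R).

Let grid_itv m k : (k <= m.+1)%N -> grid m k \in `[0, T].
Proof.
move=> km; rewrite /grid in_itv/= mulr_ge0 ?divr_ge0 ?(ltW T_gt0)//= mulrCA ger_pMr//.
by rewrite ler_pdivrMr ?ltr0n// mul1r ler_nat.
Qed.

Let grid_ge0 m k : 0 <= grid m k.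
Proof. by rewrite mulr_ge0// divr_ge0// ltW. Qed.

Let measurable_nu_ne a b : 0 <= a -> 0 <= b ->
  measurable [set w | nu a w <> nu b w].
Proof.
move=> a0 b0; apply: sigma_nu_measurable.
exact: sigma_process_setC (sigma_nu_eq a0 b0).
Qed.

(** Pathwise, every cell on which the nondecreasing counter changes raises it by at least 1. *)
Let sum_nu_ne_le m : (\sum_(k < m.+1) P [set w | nu (grid m k) w <> nu (grid m k.+1) w] <=
  \int[P]_w (nu T w)%:R%:E)%E.
Proof.
have mne k := measurable_nu_ne (grid_ge0 m k) (grid_ge0 m k.+1).
have PE k : P [set w | nu (grid m k) w <> nu (grid m k.+1) w] =
    (\int[P]_w (\1_[set w | nu (grid m k) w <> nu (grid m k.+1) w] w)%:E)%E.
  by rewrite integral_indic// setIT.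
under eq_bigr do rewrite PE.
rewrite -ge0_integral_sum//; last first.
  by move=> k; apply/measurable_EFinP; exact: measurable_indic.
apply: ge0_le_integral_any => [w|w]; first by apply: sume_ge0 => k _; rewrite lee_fin.
rewrite sumEFin lee_fin.
suff H n : (n <= m.+1)%N -> \sum_(k < n)
    \1_[set w | nu (grid m k) w <> nu (grid m k.+1) w] w <= (nu (grid m n) w)%:R :> R.
  apply: (le_trans (H _ (leqnn _))); rewrite ler_nat.
  by apply: nu_mono => //; have := grid_itv (leqnn m.+1); rewrite in_itv/= => /andP[].
elim: n => [_|n IHn nm]; first by rewrite big_ord0.
rewrite big_ord_recr/= (le_trans (lerD (IHn (ltnW nm)) (lexx _)))//.
have nunn : (nu (grid m n) w <= nu (grid m n.+1) w)%N.
  by apply: nu_mono => //; rewrite ler_wpM2r ?ler_nat// divr_ge0// ltW.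
rewrite indicE; have [/set_mem/= ne|_] := boolP (w \in _); last first.
  by rewrite addr0 ler_nat.
rewrite -natrD ler_nat addn1 ltn_neqAle nunn andbT; exact/eqP.
Qed.

(** The constant is the expectation of [nu T], independent of the level and of the grid. *)
Lemma expected_Ud_le : exists C : R, forall u,
  (expected_Ud P T (fun t w => Z t w + J t w)%R u <= C%:E * tail u)%E.
Proof.
have [_ [A JA] _] := J_nu.
have int_lty : (\int[P]_w (nu T w)%:R%:E < +oo)%E.
  by have [W [W_iid nuP]] := poisson; exact: (poisson_integrable lambda_gt0 W_iid nuP T_gt0).
have int_ge0 : (0 <= \int[P]_w (nu T w)%:R%:E)%E by apply: integral_ge0.
have int_fin : (\int[P]_w (nu T w)%:R%:E)%E \is a fin_num by rewrite ge0_fin_numE.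
exists (fine (\int[P]_w (nu T w)%:R%:E)) => u; rewrite fineK//.
pose E m k := [set w | J (grid m k) w <> J (grid m k.+1) w] `&`
  [set w | u < Z (grid m k.+1) w + J (grid m k.+1) w].
have mE m (k : 'I_m.+1) : measurable (E m k).
  apply: measurableI.
    apply: sigma_J_measurable; apply: sigma_process_setC.
    exact: sigma_J_eq (grid_itv (ltnW (ltn_ord k))) (grid_itv (ltn_ord k)).
  have mX : measurable_fun setT (fun w => Z (grid m k.+1) w + J (grid m k.+1) w).
    exact: measurable_funD.
  have := mX measurableT _ (measurable_tail u); rewrite setTI.
  by congr (measurable _); apply/seteqP; split => w /=; rewrite in_itv/= andbT.
pose f m w : \bar R := (\sum_(k < m.+1) (\1_(E m k) w)%:E)%E.
have mf m : measurable_fun setT (f m).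
  by apply: emeasurable_sum => k; apply/measurable_EFinP; exact: measurable_indic.
have f0 m w : (0 <= f m w)%E by apply: sume_ge0 => k _; rewrite lee_fin.
apply: (@le_trans _ _ (\int[P]_w limn_einf (f^~ w))%E).
  apply: ge0_le_integral_any => w; first exact: measure_ge0.
  have cardD := @card_discontinuous_upcrossings R T u (fun t => Z t w)
    (fun t => J t w) (fun n => A n w) (fun t => nu t w) T_gt0 (@Z_cont w)
    (fun t => JA t w) (@nu_right w) (@nu_left w).
  have := @counting_le_limn_einf R _ _ _ cardD.
  move/le_trans; apply; rewrite le_eqVlt; apply/orP; left; apply/eqP.
  congr limn_einf; apply/funext => m; rewrite /f sumEFin natr_sum; congr EFin.
  apply: eq_bigr => k _; rewrite indicE; congr (_%:R); congr nat_of_bool.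
  rewrite /E; apply/idP/idP => [/andP[/eqP Jne uX]|]; first exact/mem_set.
  by move/set_mem => [/= /eqP -> ->].
apply: le_trans (fatou P measurableT mf (fun m w _ => f0 m w)) _.
apply: limn_einf_le => m; rewrite ge0_integral_sum//; last first.
  by move=> k; apply/measurable_EFinP; exact: measurable_indic.
apply: (@le_trans _ _ (\sum_(k < m.+1)
    P [set w | nu (grid m k) w <> nu (grid m k.+1) w] * tail u)%E).
  apply: lee_sum => k _; rewrite integral_indic// setIT.
  apply: jump_above_le; apply: grid_itv; [exact: ltnW|exact: ltn_ord].
rewrite -ge0_sume_distrl//.
by rewrite lee_wpmul2r// ?measure_ge0// sum_nu_ne_le.
Qed.

(** The process with its jump part frozen at time 0. Its paths are C^1 on [0, T] for every outcome,
    and before time T they coincide with those of X on [no_jump]. *)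
Let X0 t w := Z t w + J 0 w.

Let T0 : 0 \in `[0, T]. Proof. by rewrite in_itv/= lexx ltW. Qed.

Let mX0 t : measurable_fun setT (X0 t). Proof. exact: measurable_funD. Qed.

Let measurable_fun_set (f : Omega -> R) (B : set R) :
  measurable_fun setT f -> measurable B -> measurable [set w | B (f w)].
Proof. by move=> mf mB; have := mf measurableT B mB; rewrite setTI. Qed.

Let measurable_le (f : Omega -> R) c : measurable_fun setT f ->
  measurable [set w | f w <= c].
Proof. by move=> mf; exact: (measurable_fun_set mf (measurable_itv `]-oo, c])). Qed.

Let measurable_lt (f : Omega -> R) c : measurable_fun setT f ->
  measurable [set w | f w < c].
Proof. by move=> mf; exact: (measurable_fun_set mf (measurable_itv `]-oo, c[)). Qed.

Let measurable_ge (f : Omega -> R) c : measurable_fun setT f ->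
  measurable [set w | c <= f w].
Proof.
move=> mf; have := measurable_fun_set mf (measurable_itv `[c, +oo[).
by congr (measurable _); apply/seteqP; split => w /=; rewrite in_itv/= andbT.
Qed.

Let measurable_gt (f : Omega -> R) c : measurable_fun setT f ->
  measurable [set w | c < f w].
Proof.
move=> mf; have := measurable_fun_set mf (measurable_itv `]c, +oo[).
by congr (measurable _); apply/seteqP; split => w /=; rewrite in_itv/= andbT.
Qed.

Lemma X0_law t : t \in `[0, T] -> has_law P (X0 t) (normal_prob 0 sgX).
Proof.
move=> tT B mB; have [_ _ J_law] := J_nu.
have sF : sigma_process `[0, T] J setT.
  by rewrite -(preimage_setT (J 0)); exact: sigma_process_preimage.
have sH : sigma_process `[0, +oo[ nu setT.
  rewrite -(preimage_setT (nu 0)); apply: sigma_process_preimage => //=.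
  by rewrite in_itv/= lexx.
have V A : measurable A ->
    P (setT `&` J 0 @^-1` A) = (P setT * normal_prob 0 sgJ A)%E.
  exact: (J_law 0 setT A (lexx 0) sH).
have E := indep_gauss_sum measurableT sgJ0 (Z_law tT) (Z_indep tT T0 sF) V mB.
transitivity (P (setT `&` [set w | B (Z t w + J 0 w)])); first by rewrite setTI.
transitivity (P setT * normal_prob 0 sgX B)%E; first exact: E.
by rewrite probability_setT mul1e.
Qed.

Let sgX0 : sgX != 0.
Proof. by rewrite gt_eqF// sqrtr_gt0 ltr_wpDl ?sqr_ge0// exprn_even_gt0. Qed.

Lemma X0_near t u l : t \in `[0, T] -> 0 <= l ->
  (P [set w | (u - l <= X0 t w)%R /\ (X0 t w <= u)%R] <= (normal_peak sgX * l)%:E)%E.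
Proof.
move=> tT l0; have mI : measurable (`[u - l, u]%classic : set R) by exact: measurable_itv.
have -> : [set w | u - l <= X0 t w /\ X0 t w <= u] = X0 t @^-1` `[u - l, u].
  by apply/seteqP; split => w /=; rewrite in_itv/= => /andP.
rewrite X0_law// /normal_prob.
apply: (@le_trans _ _ (\int[lebesgue_measure]_(x in `[(u - l)%R, u]) (normal_peak sgX)%:E)%E).
  apply: ge0_le_integral => //.
  - by move=> x _; rewrite lee_fin normal_pdf_ge0.
  - by apply/measurable_EFinP/measurable_funTS; exact: measurable_normal_pdf.
  - by move=> x _; rewrite lee_fin normal_pdf_ub.
rewrite integral_cst//; have := lebesgue_measure_itv `[u - l, u].
rewrite [X in (_ * X)%E]/= => ->; rewrite /= lte_fin.
case: ifPn => _; last by rewrite mule0 lee_fin mulr_ge0// normal_peak_ge0.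
by rewrite -EFinD -EFinM lee_fin opprB addrCA subrr addr0.
Qed.

Let measurable_good e p q :
  measurable [set w | good_piece (fun t => Z t w) e p q].
Proof.
(* The pairs of rationals are enumerated by their codes; a number that codes no pair contributes
   [setT]. *)
pose A n := if (choice.unpickle n : option (rat * rat)%type) is Some ab then
  [set w | p <= ratr ab.1 -> ratr ab.1 < ratr ab.2 :> R -> ratr ab.2 <= q ->
    e * (ratr ab.2 - ratr ab.1) <= Z (ratr ab.2) w - Z (ratr ab.1) w]
  else setT.
have -> : [set w | good_piece (fun t => Z t w) e p q] = \bigcap_n A n.
  apply/seteqP; split => w /=.
    by move=> good n _; rewrite /A; case: choice.unpickle => // -[a b] /= pa ab bq; exact: good.
  by move=> h a b; have := h (choice.pickle (a, b)) Logic.I; rewrite /A choice.pickleK.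
apply: bigcapT_measurable => n; rewrite /A; case: choice.unpickle => [[a b]/=|//].
have [/and3P[pa ab bq]|nc] := boolP [&& p <= ratr a, ratr a < ratr b :> R & ratr b <= q].
  have -> : [set w | p <= ratr a -> ratr a < ratr b :> R -> ratr b <= q ->
      e * (ratr b - ratr a) <= Z (ratr b) w - Z (ratr a) w] =
      [set w | e * (ratr b - ratr a) <= Z (ratr b) w - Z (ratr a) w].
    by apply/seteqP; split => w /= h => [|_ _ _]; exact: h.
  by apply: measurable_ge; exact: measurable_funB.
rewrite (_ : [set w | _] = setT)//; apply/seteqP; split => // w _ /= pa ab bq.
by move: nc; rewrite pa ab bq.
Qed.

(* On a fine grid of [a, b], consider the piece on which [X0] first exceeds [u].
   Either it starts less than [e] times its length below [u], which is unlikely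
   as [X0] has a bounded density, or its slope is at least [e], and then the
   uniform continuity of Z' makes Z' positive all along the piece. *)
Lemma robust_crossing a b u eta : 0 <= a -> a < b -> b <= T -> 0 < eta ->
  exists G : set Omega, [/\ measurable G,
    (P ([set w | X0 a w < u /\ u < X0 b w]%R `\` G) <= eta%:E)%E &
    forall w, G w -> exists s, [/\ a < s < b, X0 s w = u,
      derivable (fun t => Z t w) s 1 & 0 < (fun t => Z t w)^`()%classic s]].
Proof.
move=> a0 ab bT eta0.
set C := normal_peak sgX; have C0 : 0 < C by exact: normal_peak_gt0.
have ba0 : 0 < b - a by rewrite subr_gt0.
have eta20 : 0 < eta / 2 by rewrite divr_gt0.
(* With M + 1 pieces, each starts too close to [u] with probability at most C * e * (b - a) / (M +
   1); these bounds add up to [eta / 2]. *)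
pose e := eta / 2 / (C * (b - a)).
have e0 : 0 < e by rewrite divr_gt0// mulr_gt0.
pose p m k : R := a + k%:R * ((b - a) / m.+1%:R).
have pS m k : p m k.+1 = p m k + (b - a) / m.+1%:R.
  by rewrite /p -natr1 mulrDl mul1r addrA.
have h0 m : 0 < (b - a) / m.+1%:R by rewrite divr_gt0.
have p0 m : p m 0 = a by rewrite /p mul0r addr0.
have pb m : p m m.+1 = b by rewrite /p mulrC divfK ?pnatr_eq0// addrC subrK.
have p_mono m k l : (k <= l)%N -> p m k <= p m l.
  by move=> kl; rewrite lerD2l ler_wpM2r ?ler_nat// ltW.
have p_lt m k : p m k < p m k.+1 by rewrite pS ltrDl.
have p_ge m k : a <= p m k by rewrite -[leLHS](p0 m); exact: p_mono.
have p_le m k : (k <= m.+1)%N -> p m k <= b by rewrite -[leRHS](pb m); exact: p_mono.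
have pT m k : (k <= m.+1)%N -> p m k \in `[0, T].
  by move=> km; rewrite in_itv/= (le_trans a0)//= (le_trans (p_le _ _ km)).
pose good m k := [set w | good_piece (fun t => Z t w) (e / 2) (p m k) (p m k.+1)].
pose steep m k := [set w | e * (p m k.+1 - p m k) < Z (p m k.+1) w - Z (p m k) w].
pose bad1 m k := steep m k `&` ~` good m k.
pose bad m := \big[setU/set0]_(k < m.+1) bad1 m k.
have mbad m : measurable (bad m).
  apply: bigsetU_measurable => k _; apply: measurableI.
    by apply: measurable_gt; exact: measurable_funB.
  exact/measurableC/measurable_good.
(* Some grid of index at least [M] has a steep piece that is not good. Each path has its own
   threshold beyond which this stops, so these events decrease to the empty set and their
   probabilities tend to 0: one [M] then serves all paths outside a small event. *)
pose H M := \bigcup_m bad (M + m)%N.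
have mH M : measurable (H M) by exact: bigcup_measurable.
have H0 : \bigcap_M H M = set0.
  apply/seteqP; split => // w hw.
  have [r r0 hr] := steep_pieces_good (Z_C1 w) e0.
  have [M _ hM] := cvg_small (b - a) r0.
  have [m _] := hw M Logic.I.
  rewrite /bad -(bigcup_mkord _ (bad1 _)) => -[k /= km [st ng]]; apply: ng; apply: hr => //.
  - exact: le_trans (p_ge _ _).
  - by rewrite (le_trans (p_le _ _ _)).
  - by rewrite pS addrAC subrr add0r; apply: hM => /=; exact: leq_addr.
have [M HM] : exists M, (P (H M) <= (eta / 2)%:E)%E.
  have cvgH : P (H M) @[M --> \oo] --> P (\bigcap_M H M).
    apply: nonincreasing_cvg_mu => //.
    - by rewrite ltey_eq fin_num_measure.
    - exact: bigcap_measurable.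
    - move=> i j ij; apply/subsetPset => w [m _ hw]; exists (j - i + m)%N => //.
      by rewrite addnA subnKC.
  rewrite H0 measure0 in cvgH.
  have : \forall M \near \oo, (P (H M) < (eta / 2)%:E)%E.
    exact: (cvgH _ (@nbhs_open_ereal_lt _ 0 (fun=> eta / 2) eta20)).
  by move=> [M _ hM]; exists M; apply/ltW/hM => /=.
pose G1 k := [set w | X0 (p M k) w < u] `&` [set w | u < X0 (p M k.+1) w] `&` good M k.
pose G := \big[setU/set0]_(k < M.+1) G1 k.
have mG : measurable G.
  apply: bigsetU_measurable => k _; apply: measurableI; last exact: measurable_good.
  by apply: measurableI; [exact: measurable_lt|exact: measurable_gt].
exists G; split=> //; last first.
  move=> w; rewrite /G -(bigcup_mkord _ G1) => -[k /= kM [[Xk Xk1] gk]].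
  have zp : Z (p M k) w < u - J 0 w by rewrite ltrBrDr.
  have zq : u - J 0 w < Z (p M k.+1) w by rewrite ltrBlDr.
  have pk0 := le_trans a0 (p_ge M k); have pkT := le_trans (p_le M k.+1 kM) bT.
  have e20 : 0 < e / 2 by rewrite divr_gt0.
  have [t [/andP[kt tk] Zt dZ Z'0]] :=
    good_piece_crossing (Z_C1 w) e20 pk0 pkT (p_lt M k) zp zq gk.
  exists t; split => //.
    by rewrite (le_lt_trans (p_ge _ _) kt) (lt_le_trans tk (p_le _ _ kM)).
  by rewrite /X0 Zt subrK.
pose near k := [set w | (u - e * ((b - a) / M.+1%:R) <= X0 (p M k) w)%R /\ (X0 (p M k) w <= u)%R].
have mnear k : measurable (near k).
  have -> : near k = [set w | u - e * ((b - a) / M.+1%:R) <= X0 (p M k) w] `&`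
    [set w | X0 (p M k) w <= u] by [].
  by apply: measurableI; [exact: measurable_ge|exact: measurable_le].
pose nears := \big[setU/set0]_(k < M.+1) near k.
have mnears : measurable nears by exact: bigsetU_measurable.
have mE : measurable [set w | X0 a w < u /\ u < X0 b w].
  have -> : [set w | X0 a w < u /\ u < X0 b w] = [set w | X0 a w < u] `&`
    [set w | u < X0 b w] by [].
  by apply: measurableI; [exact: measurable_lt|exact: measurable_gt].
(* Take the first grid point above [u] and the piece that ends there: it starts close to [u], or it
   is steep, and then it is good unless the path lies in [H M]. *)
have sub : [set w | X0 a w < u /\ u < X0 b w] `\` G `<=` nears `|` H M.
  move=> w [/= [Xa Xb] nG].
  have ex : exists k, u < X0 (p M k) w by exists M.+1; rewrite pb.
  have [k uk kmin] := ex_minnP ex; case: k uk kmin => [|k] uk kmin.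
    by move: uk; rewrite p0 ltNge ltW.
  have kM : (k < M.+1)%N by apply: kmin; rewrite pb.
  have ku : X0 (p M k) w <= u by rewrite leNgt; apply/negP => /kmin; rewrite ltnn.
  have [nr|nr] := leP (u - e * ((b - a) / M.+1%:R)) (X0 (p M k) w).
    by left; rewrite /nears -(bigcup_mkord _ near); exists k.
  right; exists 0%N => //; rewrite addn0 /bad -(bigcup_mkord _ (bad1 _)); exists k => //.
  have Xku : X0 (p M k) w < u.
    by rewrite (lt_le_trans nr)// lerBlDr lerDl mulr_ge0// ltW.
  split; last by move=> gk; apply: nG; rewrite /G -(bigcup_mkord _ G1); exists k.
  rewrite /steep /=.
  have -> : p M k.+1 - p M k = (b - a) / M.+1%:R by rewrite pS addrAC subrr add0r.
  move: uk nr; rewrite /X0.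
  by move: (e * _) (Z (p M k) w) (Z (p M k.+1) w) (J 0 w) => x y z v; lra.
have := le_measure P _ _ sub; rewrite !inE => /(_ (measurableD mE mG)).
move=> /(_ (measurableU _ _ mnears (mH M))) /le_trans; apply.
apply: (le_trans (measureU2 _ mnears (mH M))).
rewrite (splitr eta) EFinD leeD//.
apply: (le_trans (Boole_inequality _ _)) => //.
apply: (@le_trans _ _ (\sum_(k < M.+1) (C * (e * ((b - a) / M.+1%:R)))%:E)%E).
  apply: lee_sum => k _; apply: X0_near; first by apply: pT; exact/ltnW/ltn_ord.
  by rewrite mulr_ge0// ltW.
rewrite sumEFin lee_fin sumr_const card_ord -[leLHS]mulr_natr /e.
have M0 : M.+1%:R != 0 :> R by rewrite pnatr_eq0.
rewrite le_eqVlt; apply/orP; left; apply/eqP.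
move: (M.+1%:R) M0 => m M0; field.
by rewrite M0 !gt_eqF.
Qed.

(** Stated through values of J at rational times, so that the event belongs to the sigma-algebra of
    J, as the independence of Z requires. *)
Let no_jump := [set w | forall q : rat, ratr q \in `[0, T] -> J (ratr q) w = J 0 w].

Let sigma_no_jump : sigma_process `[0, T] J no_jump.
Proof.
pose A n := if (choice.unpickle n : option rat) is Some q then
  [set w | ratr q \in `[0, T] -> J (ratr q) w = J 0 w] else setT.
have -> : no_jump = \bigcap_n A n.
  apply/seteqP; split => w /=.
    by move=> nj n _; rewrite /A; case: choice.unpickle => // q /= qT; exact: nj.
  by move=> h q; have := h (choice.pickle q) Logic.I; rewrite /A choice.pickleK.
have sT : sigma_process `[0, T] J setT.
  by rewrite -(preimage_setT (J 0)); exact: sigma_process_preimage.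
apply: sigma_process_bigcap => n; rewrite /A; case: choice.unpickle => [q|//].
have [qT|nqT] := boolP ((ratr q : R) \in `[0, T]).
  have -> : [set w | true -> J (ratr q) w = J 0 w] = [set w | J (ratr q) w = J 0 w].
    by apply/seteqP; split => w /= h; [exact: h|].
  exact: sigma_J_eq.
have -> : [set w | false -> J (ratr q) w = J 0 w] = setT by apply/seteqP; split.
exact: sT.
Qed.

(** By right-continuity of the counter, [J t] equals the value of J at some rational time just after
    [t]; hence the restriction to [t < T]. *)
Let no_jump_const w t : no_jump w -> 0 <= t -> t < T -> J t w = J 0 w.
Proof.
move=> njw t0 tT; have [_ [A JA] _] := J_nu.
have [e /= e0 he] := @nu_right w t t0.
have te : t < Num.min (t + e) T by rewrite lt_min ltrDl e0.
have [q] := rat_in_itvoo te; rewrite in_itv/= lt_min => /and3P[tq qe qT].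
have q0 : 0 <= ratr q :> R by rewrite (le_trans t0)// ltW.
rewrite JA// -(he (ratr q))//; last first.
  by rewrite /ball_/= ltr_distlC qe andbT (le_lt_trans _ tq)// lerBlDr lerDl ltW.
by rewrite -JA//; apply: njw; rewrite in_itv/= q0 ltW.
Qed.

Lemma no_jump_upcrossing w u t : no_jump w -> 0 < t -> t < T -> X0 t w = u ->
  derivable (fun t => Z t w) t 1 -> 0 < (fun t => Z t w)^`()%classic t ->
  continuous_upcrossings T u (fun t => Z t w + J t w) t.
Proof.
move=> njw t0 tT Xt dZ Z'.
have nearX : \forall t' \near t, Z t' w + J 0 w = Z t' w + J t' w.
  have : \forall t' \near t, t' \in `]0, T[ by apply: near_in_itvoo; rewrite in_itv/= t0.
  apply: filterS => t'; rewrite in_itv/= => /andP[t'0 t'T].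
  by rewrite (no_jump_const njw (ltW t'0) t'T).
have dX0 : derivable (fun t => Z t w + J 0 w) t 1 by exact: derivableD.
have dX := near_eq_derivable nearX dX0.
split=> //.
- by rewrite in_itv/= t0.
- by apply: differentiable_continuous; apply/derivable1_diffP.
- by rewrite no_jump_const// ltW.
- rewrite derive1E; have -> : 'D_1 (fun t => Z t w + J t w) t = 'D_1 (fun t => Z t w) t.
    transitivity ('D_1 (fun t => Z t w + J 0 w) t).
      apply: esym; exact: near_eq_derive nearX.
    transitivity ('D_1 (fun t => Z t w) t + 'D_1 (cst (J 0 w)) t).
      exact: (deriveD dZ (derivable_cst _ _ _)).
    by rewrite derive_cst addr0.
  by rewrite -derive1E.
Qed.

Let p0 := P [set w | nu T w = nu 0 w].

(** Converse device to [jump_above_le]: [no_jump] is shrunk to the event that [nu] is constant on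
    [0, T], on which [J 0] has [p0] times its Gaussian law. *)
Lemma no_jump_above_ge t u : t \in `[0, T] ->
  (p0 * tail u <= P (no_jump `&` [set w | (u < X0 t w)%R]))%E.
Proof.
move=> tT; have [_ [A JA] J_law] := J_nu.
have mF := sigma_J_measurable sigma_no_jump.
have := indep_gauss_sum_ge mF sgJ0 (measure_ge0 P _ : (0 <= p0)%E) (Z_law tT)
  (Z_indep tT T0 sigma_no_jump) (measurable_tail u).
have -> : [set w | `]u, +oo[%classic (Z t w + J 0 w)] = [set w | u < X0 t w].
  by apply/seteqP; split => w /=; rewrite in_itv/= andbT.
apply=> B mB.
have sH := sigma_nu_eq (ltW T_gt0) (lexx 0).
rewrite -(J_law 0 _ B (lexx 0) sH mB); apply: le_measure; rewrite ?inE.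
- by apply: measurableI; [exact: sigma_nu_measurable|exact: measurable_funPTI].
- by apply: measurableI => //; exact: measurable_funPTI.
- move=> w [/= nuT0 BJ]; split => // q; rewrite in_itv/= => /andP[q0 qT].
  rewrite !JA//; congr A; apply/eqP; rewrite eqn_leq (nu_mono w (lexx 0) q0) andbT.
  by rewrite -nuT0; exact: nu_mono.
Qed.

(** Both terms contain the same [J 0], so halving the sum reduces only the Z part of the variance,
    from [s ^+ 2] to [(s1 / 2) ^+ 2]. *)
Lemma pair_above t t' s1 u : t \in `[0, T] -> t' \in `[0, T] ->
  has_law P (fun w => Z t w + Z t' w) (gauss 0 s1) ->
  P [set w | (2 * u < X0 t w + X0 t' w)%R] =
  normal_prob 0 (Num.sqrt ((s1 / 2) ^+ 2 + sgJ ^+ 2)) `]u, +oo[.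
Proof.
move=> tT t'T S_law; have [_ _ J_law] := J_nu.
pose f w := (Z t w + Z t' w) / 2.
have mf : measurable_fun setT f by apply: measurable_funM => //; exact: measurable_funD.
pose Y : {RV P >-> R} := mfun_Sub (mem_set mf).
have Y_law : has_law P Y (gauss 0 (s1 / 2)).
  move=> B mB; have -> : s1 / 2 = 2^-1 * s1 by rewrite mulrC.
  have -> : gauss 0 (2^-1 * s1) B = gauss (2^-1 * 0 + 0) (2^-1 * s1) B.
    by rewrite mulr0 addr0.
  rewrite -gauss_affine// -S_law; last first.
    have : measurable_fun setT (fun x : R => 2^-1 * x + 0).
      by apply: measurable_funD => //; exact: measurable_funM.
    by move=> /(_ measurableT B mB); rewrite setTI.
  congr (P _); apply/seteqP; split => w /=; rewrite /Y /= /f addr0 mulrC//.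
have sZ B : measurable B -> sigma_process `[0, T] Z (Y @^-1` B).
  have mt := @sigma_process_measurable_fun _ _ _ _ _ `[0, T]%classic Z t tT.
  have mt' := @sigma_process_measurable_fun _ _ _ _ _ `[0, T]%classic Z t' t'T.
  have mY := measurable_funM (measurable_funD mt mt') (measurable_cst (2^-1 : R)).
  by move=> mB; have := mY measurableT B mB; rewrite setTI.
have sT : sigma_process `[0, T] J setT.
  by rewrite -(preimage_setT (J 0)); exact: sigma_process_preimage.
have sH : sigma_process `[0, +oo[ nu setT.
  rewrite -(preimage_setT (nu 0)); apply: sigma_process_preimage => //=.
  by rewrite in_itv/= lexx.
have V A : measurable A ->
    P (setT `&` J 0 @^-1` A) = (P setT * normal_prob 0 sgJ A)%E.
  exact: (J_law 0 setT A (lexx 0) sH).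
have indep A B : measurable A -> measurable B ->
    P (Y @^-1` A `&` (setT `&` J 0 @^-1` B)) =
    (P (Y @^-1` A) * P (setT `&` J 0 @^-1` B))%E.
  move=> mA mB; apply: ZJ_indep; first exact: sZ.
  by apply: sigma_process_setI => //; exact: sigma_process_preimage.
have E := indep_gauss_sum measurableT sgJ0 Y_law indep V (measurable_tail u).
transitivity (P (setT `&` [set w | `]u, +oo[%classic (Y w + J 0 w)])).
  rewrite setTI; congr (P _); apply/seteqP; split => w /=; rewrite in_itv/= andbT /f /X0; lra.
transitivity (P setT * normal_prob 0 (Num.sqrt ((s1 / 2) ^+ 2 + sgJ ^+ 2)) `]u, +oo[)%E.
  exact: E.
by rewrite probability_setT mul1e.
Qed.

Lemma expected_Uc_ge h (N : nat) s1 u : 0 < h -> N%:R * h <= T ->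
  (forall t, 0 <= t -> t + h <= T ->
    has_law P (fun w => Z t w + Z (t + h) w) (gauss 0 s1)) ->
  (N%:R%:E * (p0 * tail u) <=
   expected_Uc P T (fun t w => Z t w + J t w)%R u +
   N%:R%:E * normal_prob 0 (Num.sqrt ((s1 / 2) ^+ 2 + sgJ ^+ 2)) `]u, +oo[)%E.
Proof.
move=> h0 NhT pair_law.
set q := normal_prob _ _ _; set EU := expected_Uc _ _ _ _.
pose t (i : nat) : R := i%:R * h.
have tS i : t i.+1 = t i + h by rewrite /t -natr1 mulrDl mul1r.
have t_ge0 i : 0 <= t i by rewrite mulr_ge0// ltW.
have t_mono i j : (i <= j)%N -> t i <= t j by move=> ij; rewrite ler_pM2r// ler_nat.
have tT i : (i <= N)%N -> t i <= T by move=> /t_mono /le_trans; apply.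
have t_itv i : (i <= N)%N -> t i \in `[0, T] by move=> iN; rewrite in_itv/= t_ge0 tT.
have t_lt i : t i < t i.+1 by rewrite tS ltrDl.
(* The slack [e] pays for the exceptional events of [robust_crossing], [e / N] for each of the [N]
   pieces; hence the separate case N = 0. *)
apply/lee_addgt0Pr => e e0.
have [->|N0] := eqVneq N 0%N.
  rewrite !mul0e adde0; apply: adde_ge0; last by rewrite lee_fin ltW.
  by apply: integral_ge0 => w _; exact: measure_ge0.
have NR0 : 0 < N%:R :> R by rewrite ltr0n lt0n.
have eN : 0 < e / N%:R by rewrite divr_gt0.
have /boolp.choice[G hG] (i : 'I_N) :=
  robust_crossing u (t_ge0 i) (t_lt i) (tT _ (ltn_ord i)) eN.
have mF := sigma_J_measurable sigma_no_jump.
have mFG i : measurable (no_jump `&` G i) by have [mG _ _] := hG i; exact: measurableI.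
(* Each certified piece contains a crossing in its interior, and the interiors are disjoint, so the
   crossings chosen are distinct. *)
have lower : (\sum_(i < N) P (no_jump `&` G i) <= EU)%E.
  have PE i : P (no_jump `&` G i) = (\int[P]_w (\1_(no_jump `&` G i) w)%:E)%E.
    by rewrite integral_indic// setIT.
  under eq_bigr do rewrite PE.
  rewrite -ge0_integral_sum//; last first.
    by move=> i; apply/measurable_EFinP; exact: measurable_indic.
  apply: ge0_le_integral_any => [w|w]; first by apply: sume_ge0 => k _; rewrite lee_fin.
  pose b : pred 'I_N := [pred i | w \in no_jump `&` G i].
  have -> : (\sum_(i < N) (\1_(no_jump `&` G i) w)%:E = (#|b|%:R : R)%:E)%E.
    rewrite sumEFin -sum1_card natr_sum; congr EFin.
    rewrite [RHS]big_mkcond; apply: eq_bigr => i _; rewrite indicE inE/=.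
    by case: (w \in _).
  have crossing (i : 'I_N) : exists y, b i -> t i < y < t i.+1 /\
      continuous_upcrossings T u (fun t => Z t w + J t w) y.
    have [/set_mem[njw Gw]|nb] := boolP (w \in no_jump `&` G i); last first.
      by exists 0; rewrite /b /= (negbTE nb).
    have [_ _ /(_ w Gw)[y [/andP[iy yi] Xy dZ Z']]] := hG i.
    exists y => _; split; first by rewrite iy yi.
    apply: no_jump_upcrossing => //; first exact: le_lt_trans iy.
    exact: lt_le_trans (tT _ (ltn_ord i)).
  have [y hy] := boolp.choice crossing.
  apply: (@counting_ge _ _ _ _ b y); last by move=> i /hy[].
  move=> i j /hy[/andP[iy yi] _] /hy[/andP[jy yj] _] yij.
  apply: val_inj => /=; case: (ltngtP i j) => // [ij|ji].
    by have := lt_trans (lt_le_trans yi (t_mono _ _ ij)) jy; rewrite yij ltxx.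
  by have := lt_trans (lt_le_trans yj (t_mono _ _ ji)) iy; rewrite yij ltxx.
(* When [X0] exceeds [u] at the right end and J does not jump, there are three cases: the piece has
   a certified crossing, the values at its two ends have sum above 2 u, or it crosses without a
   certificate. *)
have piece (i : 'I_N) : (p0 * tail u <= P (no_jump `&` G i) + (q + (e / N%:R)%:E))%E.
  have iN := ltn_ord i; have [mG PG _] := hG i.
  have mX1 : measurable [set w | u < X0 (t i.+1) w] by exact: measurable_gt.
  have mX2 : measurable [set w | 2 * u < X0 (t i) w + X0 (t i.+1) w].
    by apply: measurable_gt; exact: measurable_funD.
  have mE : measurable [set w | X0 (t i) w < u /\ u < X0 (t i.+1) w].
    have -> : [set w | X0 (t i) w < u /\ u < X0 (t i.+1) w] =
      [set w | X0 (t i) w < u] `&` [set w | u < X0 (t i.+1) w] by [].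
    by apply: measurableI => //; exact: measurable_lt.
  apply: (le_trans (no_jump_above_ge u (t_itv _ iN))).
  pose B1 := no_jump `&` G i; pose B2 := [set w | 2 * u < X0 (t i) w + X0 (t i.+1) w].
  pose B3 := [set w | X0 (t i) w < u /\ u < X0 (t i.+1) w] `\` G i.
  have mB3 : measurable B3 by exact: measurableD.
  have mB23 : measurable (B2 `|` B3) by exact: measurableU.
  have PB2 : P B2 = q.
    apply: pair_above; [exact/t_itv/ltnW|exact: t_itv|].
    by rewrite tS; apply: pair_law => //; rewrite -tS; exact: tT.
  apply: (@le_trans _ _ (P (B1 `|` (B2 `|` B3)))).
    apply: le_measure.
    - by apply: mem_set; exact: measurableI.
    - by apply: mem_set; apply: measurableU => //; exact: mFG.
    move=> w [/= njw uX].
    have [uX'|X'u] := leP u (X0 (t i) w).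
      by right; left; rewrite /B2 /= mulr2n mulrDl !mul1r ler_ltD.
    have [Gw|nGw] := boolP (w \in G i); first by left; split => //; exact/set_mem.
    by right; right; split => //; move/negP: nGw; apply: contra_not => ?; exact/mem_set.
  apply: le_trans (measureU2 _ (mFG i) mB23) _; rewrite leeD2l//.
  by apply: le_trans (measureU2 _ mX2 mB3) _; apply: leeD => //; rewrite -PB2.
have sum_const (x : \bar R) : (\sum_(i < N) x = N%:R%:E * x)%E.
  transitivity (\sum_(i < N) (1%:E * x))%E; first by apply: eq_bigr => i _; rewrite mul1e.
  by rewrite -ge0_sume_distrl// sumEFin sumr_const card_ord.
apply: (@le_trans _ _ (\sum_(i < N) (P (no_jump `&` G i) + (q + (e / N%:R)%:E)))%E).
  by rewrite -(sum_const (p0 * tail u)%E); apply: lee_sum => i _; exact: piece.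
have q0 : (0 <= q)%E by exact: measure_ge0.
rewrite big_split/= sum_const; clearbody q; rewrite -addeA; apply: leeD => //.
rewrite ge0_muleDr// ?lee_fin ?(ltW eN)//.
by rewrite leeD// -EFinM lee_fin mulrCA divff ?mulr1// gt_eqF.
Qed.

Lemma Ud_little_o_Uc tau : 0 < tau -> tau <= T ->
  (forall N, (0 < N)%N -> exists2 s1, s1 ^+ 2 < 4 * s ^+ 2 &
    forall t, 0 <= t -> t + tau / N%:R <= T ->
    has_law P (fun w => Z t w + Z (t + tau / N%:R) w) (gauss 0 s1)) ->
  little_o_pinfty (expected_Ud P T (fun t w => Z t w + J t w))
                  (expected_Uc P T (fun t w => Z t w + J t w)).
Proof.
move=> tau0 tauT pair_law.
have [C Ud_le] := expected_Ud_le.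
have p0_gt0 : (0 < p0)%E.
  by have [W [W_iid nuP]] := poisson; exact: (poisson_no_jump lambda_gt0 W_iid nuP T_gt0).
have mno : measurable [set w | nu T w = nu 0 w].
  exact: sigma_nu_measurable (sigma_nu_eq (ltW T_gt0) (lexx 0)).
have p0_fin : p0 \is a fin_num by exact: fin_num_measure.
pose p := fine p0; have pE : p0 = p%:E by rewrite fineK.
have p_gt0 : 0 < p by rewrite -lte_fin -pE.
apply: little_o_pinfty_le => [u|eps eps0]; first by apply: integral_ge0 => w _; exact: measure_ge0.
(* Half of [p] is given up to the half-sum tail, leaving at least N * p / 2 * tail; [N] makes this
   exceed C / eps times the tail. It is fixed before [u], because [s1] and then the threshold [U]
   depend on it. *)
pose N := (Num.truncn (C / eps / (p / 2))).+1.
have N_large : C / eps / (p / 2) < N%:R by exact: truncnS_gt.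
have N0 : (0 < N)%N by [].
clearbody N.
have [s1 s1_lt s1_law] := pair_law N N0.
have sd0 : 0 < Num.sqrt ((s1 / 2) ^+ 2 + sgJ ^+ 2).
  by rewrite sqrtr_gt0 ltr_wpDl ?sqr_ge0// exprn_even_gt0.
have sd_lt : Num.sqrt ((s1 / 2) ^+ 2 + sgJ ^+ 2) < sgX.
  rewrite ltr_sqrt; last by rewrite ltr_wpDl ?sqr_ge0// exprn_even_gt0.
  by rewrite ltrD2r expr_div_n ltr_pdivrMr ?exprn_gt0// mulrC (_ : 2 ^+ 2 = 4)//; ring.
have [U q_le] := normal_tail_negligible sd0 sd_lt (divr_gt0 p_gt0 (ltr0n R 2)).
have h0 : 0 < tau / N%:R by rewrite divr_gt0// ltr0n.
have NhT : N%:R * (tau / N%:R) <= T by rewrite mulrC divfK ?pnatr_eq0 -?lt0n.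
have near_U : \forall u \near +oo, U <= u by apply: nbhs_pinfty_ge; exact: num_real.
apply: filterS near_U => u Uu.
have := expected_Uc_ge u h0 NhT s1_law.
have tail_fin : tail u \is a fin_num.
  have : (tail u <= 1)%E by exact: probability_le1.
  by move=> /le_lt_trans /(_ (ltry _)); rewrite ge0_fin_numE// measure_ge0.
have tail_gt0 := normal_tail_gt0 u sgX0.
have qu := q_le _ Uu.
pose x := fine (tail u); have xE : tail u = x%:E by rewrite fineK.
have x0 : 0 < x by rewrite -lte_fin -xE.
move: (Ud_le u) qu; rewrite -/(tail u) xE pE.
set q := normal_prob _ _ _; set EU := expected_Uc _ _ _ _; set ED := expected_Ud _ _ _ _.
move=> ED_le qu EU_ge.
have half : ((N%:R * (p / 2) * x)%:E <= EU)%E.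
  have : ((N%:R * (p * x))%:E <= EU + (N%:R * (p / 2 * x))%:E)%E.
    apply: (le_trans EU_ge); apply: leeD => //.
    by rewrite EFinM; apply: lee_wpmul2l; rewrite ?lee_fin// -?EFinM.
  have -> : N%:R * (p / 2) * x = N%:R * (p * x) - N%:R * (p / 2 * x) by field.
  by rewrite EFinB leeBlDr.
split.
  by apply: lt_le_trans half; rewrite lte_fin !mulr_gt0// ?ltr0n// divr_gt0.
apply: (le_trans ED_le); apply: (@le_trans _ _ (eps%:E * (N%:R * (p / 2) * x)%:E)%E).
  rewrite -!EFinM lee_fin [leRHS]mulrA ler_pM2r//.
  move: N_large; rewrite ltr_pdivrMr ?divr_gt0// ltr_pdivrMr// => /ltW/le_trans; apply.
  by rewrite mulrC.
by apply: lee_wpmul2l; rewrite // lee_fin ltW.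
Qed.

End upcrossing_expectations.

Theorem corollary7 (R : realType) (d : measure_display)
    (Omega : measurableType d) (P : probability Omega R)
    (T rho lambda : R) (Z J : R -> {RV P >-> R}) (Gamma : R -> R)
    (T_gt0 : 0 < T) (rho_lt1 : `|rho| < 1) (lambda_gt0 : 0 < lambda)
    (Z_gaussian : gaussian_process P `[0, T] Z)
    (Z_centered : centered_process P `[0, T] Z)
    (Z_stationary : stationary_process P `[0, T] Z)
    (Z_C1 : forall w, C1_on 0 T (fun t => Z t w))
    (Z_cov : forall tau, tau \in `[0, T] ->
       ('E_P[fun w => (Z 0 w * Z tau w)%R] = (Gamma tau)%:E)%E)
    (Gamma0 : Gamma 0 = 1 / 2)
    (Gamma_nonconstant : exists2 tau, tau \in `[0, T] & Gamma tau != Gamma 0)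
    (J_PAR : PAR_process P rho lambda J)
    (ZJ_independent : independent_systems P (sigma_process `[0, T] Z)
                                            (sigma_process `[0, T] J)) :
  little_o_pinfty (expected_Ud P T (fun t w => Z t w + J t w))
                  (expected_Uc P T (fun t w => Z t w + J t w)).
Proof.
have [nu J_nu] := PAR_jump_counter rho_lt1 J_PAR.
have [s Z_law] := Z_marginal_law T_gt0 Z_gaussian Z_centered Z_stationary Z_cov Gamma0.
have [tau tauT Gamma_tau] := Gamma_nonconstant.
have := tauT; rewrite in_itv/= => /andP[tau_ge0 tau_le].
have tau0 : 0 < tau.
  by rewrite lt_neqAle tau_ge0 andbT eq_sym; apply: contra_neq Gamma_tau => ->.
have T0 : 0 \in `[0, T] by rewrite in_itv/= lexx ltW.
apply: (Ud_little_o_Uc T_gt0 lambda_gt0 Z_C1 ZJ_independent Z_law J_nu tau0 tau_le).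
move=> N N0; exact: (Z_pair_sum_law T_gt0 Z_gaussian Z_centered Z_stationary Z_cov
  Gamma0 tauT Gamma_tau N0 (Z_law 0 T0)).
Qed.
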